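(* Let $a\in\mathbb{C}_p$, $R>0$, and let $$\mathcal{D} = D^{+}(a,R)\setminus\bigcup_{i = 1}^{M}D^{-}(x_{i},r_{i}),$$ where $x_1,\dots,x_M\in\mathbb{C}_p$, $0<r_{i} < R$ for all $i$ and the discs $D^{+}(x_{i},r_{i})$ are mutually disjoint. (The $x_{i}$ do not have to satisfy $|x_i-a|_p<R$.) Let $b\in\mathbb{C}_p$ be such that $|b - a|_{p} = |b - x_{i}|_{p} = R$ for all $i$, and let $\alpha \in \mathbb{Z}_{\geq 0}$. Suppose $f$ is a Krasner analytic function on $\mathcal{D}$. Then the integral below exists and $$\int_{\mathcal{A}(a,b),\Phi_{\alpha}}f(x)\,dx = \sum_{i = 1}^{M}\frac{1}{1 - \omega\left( \frac{a - x_{i}}{a - b}\right)^{p^{\alpha}}}\,\underset{x = x_{i}}{\mathrm{Res}}\,f(x).$$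
   Context: $p$ is an odd prime; $\mathbb{C}_p$ is the completion of an algebraic closure of $\mathbb{Q}_p$, with $|p|_p=1/p$. $D^+(c,r)$ and $D^-(c,r)$ are the closed and open discs with center $c$ and radius $r$. Arc: for $a\ne b$ in $\mathbb{C}_p$ with $R=|a-b|_p$, the arc $\mathcal{A}(a,b)$ is the open disc $\{x : |x-b|_p<R\}$. Path sequence: a function $\varphi$ defined for all integers $k\ge k_0$ (some $k_0\in\mathbb{Z}^+$), with values in $\mathbb{Z}^+$ and strictly increasing. For $f:\mathcal{A}(a,b)\to\mathbb{C}_p$ put $A_{f,\varphi}(k)=p^{-\varphi(k)}\sum_{\zeta}(x-a)f(x)$, where $x=a+(b-a)\zeta$ and $\zeta$ runs through the $p^{\varphi(k)}$-th roots of unity. A non-empty family $\Phi$ of path sequences is interlocked if for all $\varphi_1,\varphi_2\in\Phi$ there are $\varphi_3\in\Phi$ and $k_0$ such that $\varphi_3(k)$, $k\ge k_0$, is a subsequence of both $\varphi_1$ and $\varphi_2$. For interlocked $\Phi$, $\int_{\mathcal{A}(a,b),\Phi}f(x)\,dx=L$ means: for every $\varepsilon>0$ there are $\varphi_\varepsilon\in\Phi$ and $K_\varepsilon$ with $|A_{f,\varphi_\varepsilon}(k)-L|_p<\varepsilon$ for all $k>K_\varepsilon$ (such $L$ is unique if it exists). For $\alpha\in\mathbb{Z}$, $\Phi_\alpha$ is the interlocked family $\{\varphi : \varphi(k)=\alpha+\lambda k,\ \lambda=1,2,\dots\}$. $\omega$ is the Teichmüller character: for $|x|_p=1$, $\omega(x)$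 is the unique root of unity of order prime to $p$ with $|x-\omega(x)|_p<1$; $\omega(x)=0$ if $|x|_p<1$. A function on $\mathcal{D}$ (a closed disc with finitely many open discs removed) is Krasner analytic if it is the uniform limit on $\mathcal{D}$ of rational functions whose poles are outside $\mathcal{D}$. The residue $\mathrm{Res}_{x=x_i}f$ is the coefficient of $(x-x_i)^{-1}$ in the Laurent expansion of $f$ in powers of $x-x_i$ converging on the circle $|x-x_i|_p=r_i$. *)

(* Defs.v *)
From HB Require Import structures.
From mathcomp Require Import all_boot all_order all_algebra.
From mathcomp Require Import zify.
From mathcomp Require Import boolp classical_sets functions cardinality fsbigop.
From mathcomp Require Import reals.

Set Implicit Arguments.
Unset Strict Implicit.
Unset Printing Implicit Defensive.

Import Order.TTheory GRing.Theory Num.Theory.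

Local Open Scope classical_set_scope.
Local Open Scope ring_scope.

(** * The field C_p *)

(** Inside a complete valued field [K] with |p| = 1/p (so that |.| restricts to
    the p-adic absolute value on Q), the field Q_p is the closure of Q. *)
Definition in_Qp (RR : realType) (K : fieldType) (abs : K -> RR) : set K :=
  [set x | forall eps : RR, 0 < eps -> exists q : rat, abs (x - ratr q) < eps].

Definition in_Qpbar (RR : realType) (K : fieldType) (abs : K -> RR) : set K :=
  [set x | exists P : {poly K},
     [/\ P != 0, forall i, in_Qp abs P`_i & root P x]].

Definition cauchy_seq (RR : realType) (K : fieldType) (abs : K -> RR)
    (u : nat -> K) : Prop :=
  forall eps : RR, 0 < eps -> exists N : nat, forall m n : nat,
    (N <= m)%N -> (N <= n)%N -> abs (u m - u n) < eps.

Definition seq_lim (RR : realType) (K : fieldType) (abs : K -> RR)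
    (u : nat -> K) (l : K) : Prop :=
  forall eps : RR, 0 < eps -> exists N : nat, forall n : nat,
    (N <= n)%N -> abs (u n - l) < eps.

(** [is_Cp p abs]: the field [K] with the absolute value [abs] is a completion
    of an algebraic closure of Q_p.  The elements of [K] algebraic over Q_p form
    an algebraically closed field, this field is dense in [K], and [K] is
    complete.  That [K] itself is algebraically closed is a consequence, not
    part of the definition. *)
Record is_Cp (RR : realType) (p : nat) (K : fieldType) (abs : K -> RR) : Prop :=
  IsCp {
  Cp_abs_ge0 : forall x, 0 <= abs x;
  Cp_abs_eq0 : forall x, abs x = 0 -> x = 0;
  Cp_absM : forall x y, abs (x * y) = abs x * abs y;
  Cp_absD : forall x y, abs (x + y) <= Num.max (abs x) (abs y);
  Cp_abs_p : abs p%:R = p%:R^-1;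
  Cp_Qpbar_closed : forall P : {poly K},
    (forall i, in_Qpbar abs P`_i) -> (1 < size P)%N ->
    exists2 x, in_Qpbar abs x & root P x;
  Cp_Qpbar_dense : forall (x : K) (eps : RR), 0 < eps ->
    exists2 y, in_Qpbar abs y & abs (x - y) < eps;
  Cp_complete : forall u : nat -> K, cauchy_seq abs u ->
    exists l, seq_lim abs u l }.

(** * Discs, Krasner analytic functions and residues *)

Definition cdisc (RR : realType) (K : fieldType) (abs : K -> RR) (c : K)
    (r : RR) : set K := [set x | abs (x - c) <= r].

Definition odisc (RR : realType) (K : fieldType) (abs : K -> RR) (c : K)
    (r : RR) : set K := [set x | abs (x - c) < r].

(** Functions on a subset of [K] are total functions [K -> K] of which only the
    values on that subset are used.  A rational function with poles outside [D]
    is a quotient P / Q of polynomials, with Q without zeros in [D]. *)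
Definition krasner_analytic (RR : realType) (K : fieldType) (abs : K -> RR)
    (D : set K) (f : K -> K) : Prop :=
  exists P Q : nat -> {poly K},
    (forall n x, D x -> (Q n).[x] != 0) /\
    (forall eps : RR, 0 < eps -> exists N : nat, forall n : nat, (N <= n)%N ->
       forall x, D x -> abs (f x - (P n).[x] / (Q n).[x]) < eps).

(** f(x) = sum over n in Z of c_n (x - x0)^n for every x in [S]; both halves of
    the series converge, since [m] and [n] vary independently. *)
Definition laurent_expansion_on (RR : realType) (K : fieldType) (abs : K -> RR)
    (S : set K) (f : K -> K) (x0 : K) (c : int -> K) : Prop :=
  forall x, S x -> forall eps : RR, 0 < eps -> exists N : nat,
    forall m n : nat, (N <= m)%N -> (N <= n)%N ->
    abs (\sum_(0 <= k < n) c k%:Z * (x - x0) ^+ k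
         + \sum_(1 <= k < m) c (- k%:Z) * (x - x0) ^- k - f x) < eps.

(** The real number [r] need not be in the value group |K^*|, in which case the
    circle |x - x0| = r has no points and does not determine a Laurent series.
    Hence the expansion is required on an annulus r <= |x - x0| < s with s > r:
    it contains the circle, and a Krasner analytic function on it has the same
    expansion there as on the circle when the latter is not empty. *)
Definition laurent_expansion (RR : realType) (K : fieldType) (abs : K -> RR)
    (f : K -> K) (x0 : K) (r : RR) (c : int -> K) : Prop :=
  exists2 s : RR, r < s &
    laurent_expansion_on abs [set x | r <= abs (x - x0) < s] f x0 c.

(** The value is 0 when there is no Laurent expansion. *)
Definition residue (RR : realType) (K : fieldType) (abs : K -> RR)
    (f : K -> K) (x0 : K) (r : RR) : K :=
  xget 0 [set t | exists2 c : int -> K,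
                    laurent_expansion abs f x0 r c & t = c (-1)].

(** * The Teichmueller character *)

(** The value outside the closed unit disc is immaterial and set to 0. *)
Definition teichmuller (RR : realType) (p : nat) (K : fieldType)
    (abs : K -> RR) (x : K) : K :=
  if abs x == 1 then
    xget 0 [set z | (exists n : nat,
                       [/\ (0 < n)%N, coprime n p & n.-primitive_root z])
                    /\ abs (x - z) < 1]
  else 0.

(** * Path sequences and integrals along arcs *)

(** The values of [ps_fun] below [ps_start] are irrelevant. *)
Record path_seq := PathSeq {
  ps_start : nat;
  ps_fun :> nat -> nat;
  ps_start_gt0 : (0 < ps_start)%N;
  ps_fun_gt0 : forall k, (ps_start <= k)%N -> (0 < ps_fun k)%N;
  ps_fun_incr : forall k l, (ps_start <= k)%N -> (k < l)%N ->
    (ps_fun k < ps_fun l)%N }.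

Definition subseq_from (k0 : nat) (psi phi : path_seq) : Prop :=
  (ps_start psi <= k0)%N /\
  exists s : nat -> nat,
    (forall k l, (k0 <= k)%N -> (k < l)%N -> (s k < s l)%N) /\
    (forall k, (k0 <= k)%N -> (ps_start phi <= s k)%N /\ psi k = phi (s k)).

Record interlocked_family := InterlockedFamily {
  if_set : set path_seq;
  if_nonempty : if_set !=set0;
  if_interlocked : forall phi1 phi2, if_set phi1 -> if_set phi2 ->
    exists2 phi3, if_set phi3 &
    exists k0, subseq_from k0 phi3 phi1 /\ subseq_from k0 phi3 phi2 }.

(** A path sequence given by k |-> alpha + lam * k may start at any index from
    which its values are positive. *)
Definition Phi_set (alpha : int) : set path_seq :=
  [set phi | exists2 lam : nat, (0 < lam)%N &
     forall k, (ps_start phi <= k)%N -> (phi k)%:Z = alpha + (lam * k)%:Z].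

Lemma Phi_set_nonempty (alpha : int) : Phi_set alpha !=set0.
Proof.
have h0 : (0 < `|alpha|.+1)%N by [].
have h1 k : (`|alpha|.+1 <= k)%N -> (0 < absz (alpha + k%:Z)%R)%N by lia.
have h2 k l : (`|alpha|.+1 <= k)%N -> (k < l)%N ->
  (absz (alpha + k%:Z)%R < absz (alpha + l%:Z)%R)%N by lia.
by exists (PathSeq h0 h1 h2); exists 1%N => //= k hk; lia.
Qed.

Lemma Phi_set_interlocked (alpha : int) (phi1 phi2 : path_seq) :
  Phi_set alpha phi1 -> Phi_set alpha phi2 ->
  exists2 phi3, Phi_set alpha phi3 &
  exists k0, subseq_from k0 phi3 phi1 /\ subseq_from k0 phi3 phi2.
Proof.
move=> [l1 l1_gt0 h1] [l2 l2_gt0 h2].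
pose k0 := maxn (ps_start phi1) (ps_start phi2).
have k0_gt0 : (0 < k0)%N by rewrite leq_max ps_start_gt0.
have le1 k : (k0 <= k)%N -> (ps_start phi1 <= l2 * k)%N by rewrite /k0; nia.
have le2 k : (k0 <= k)%N -> (ps_start phi2 <= l1 * k)%N by rewrite /k0; nia.
have pos k : (k0 <= k)%N -> (0 < phi1 (l2 * k))%N.
  by move=> /le1; apply: ps_fun_gt0.
have inc k l : (k0 <= k)%N -> (k < l)%N ->
    (phi1 (l2 * k) < phi1 (l2 * l))%N.
  by move=> /le1 hk kl; apply: ps_fun_incr => //; rewrite ltn_pmul2l.
exists (PathSeq k0_gt0 pos inc).
  exists (l1 * l2)%N; first by rewrite muln_gt0 l1_gt0.
  by move=> k /= hk; rewrite h1 ?le1 // mulnA.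
exists k0; split; split=> //=.
- exists (fun k => l2 * k)%N; split=> [k l _ kl|k hk]; first by rewrite ltn_pmul2l.
  by split; first exact: le1.
- exists (fun k => l1 * k)%N; split=> [k l _ kl|k hk]; first by rewrite ltn_pmul2l.
  split; first exact: le2.
  apply/eqP; rewrite -eqz_nat h1 ?le1 // h2 ?le2 //.
  by rewrite !mulnA (mulnC l1).
Qed.

Definition Phi (alpha : int) : interlocked_family :=
  InterlockedFamily (Phi_set_nonempty alpha) (@Phi_set_interlocked alpha).

(** A_{f,phi}(k) along the arc A(a,b) = odisc abs b (abs (a - b)), which contains
    the points a + (b - a) z. *)
Definition path_average (p : nat) (K : fieldType) (a b : K) (f : K -> K)
    (phi : nat -> nat) (k : nat) : K :=
  p%:R ^- phi k *
  \sum_(z \in [set z : K | z ^+ (p ^ phi k) = 1])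
     (let x := a + (b - a) * z in (x - a) * f x).

(** [arc_integral p abs a b F f L]: the integral of [f] over the arc A(a,b) with
    respect to [F] exists and is equal to [L]. *)
Definition arc_integral (RR : realType) (p : nat) (K : fieldType)
    (abs : K -> RR) (a b : K) (F : interlocked_family) (f : K -> K) (L : K)
    : Prop :=
  forall eps : RR, 0 < eps -> exists2 phi : path_seq, if_set F phi &
    exists N : nat, forall k : nat, (ps_start phi <= k)%N -> (N < k)%N ->
      abs (path_average p a b f phi k - L) < eps.

Lemma arc_integral_unique (RR : realType) (p : nat) (K : fieldType)
    (abs : K -> RR) (a b : K) (F : interlocked_family) (f : K -> K)
    (L1 L2 : K) :
  is_Cp p abs -> arc_integral p abs a b F f L1 ->
  arc_integral p abs a b F f L2 -> L1 = L2.
Proof.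
move=> hK int1 int2; apply/eqP; rewrite -subr_eq0; apply/eqP.
apply: (Cp_abs_eq0 hK); apply/eqP; rewrite eq_le (Cp_abs_ge0 hK) andbT.
rewrite leNgt; apply/negP => eps_gt0.
have [phi1 F1 [N1 h1]] := int1 _ eps_gt0.
have [phi2 F2 [N2 h2]] := int2 _ eps_gt0.
have [phi3 _ [k0 [[_ [s [s_incr hs]]] [_ [t [t_incr ht]]]]]] :=
  if_interlocked F1 F2.
have growth (u : nat -> nat) :
    (forall k l, (k0 <= k)%N -> (k < l)%N -> (u k < u l)%N) ->
    forall n, (n <= u (k0 + n))%N.
  move=> u_incr; elim=> [//|n IHn]; apply: leq_ltn_trans IHn _.
  by apply: u_incr; rewrite ?leq_addr // addnS.
pose k := (k0 + (N1 + N2).+1)%N.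
have k0k : (k0 <= k)%N by rewrite leq_addr.
have [s_ge s_eq] := hs k k0k; have [t_ge t_eq] := ht k k0k.
have d1 : abs (path_average p a b f phi1 (s k) - L1) < abs (L1 - L2).
  apply: h1 => //; apply: leq_trans (growth s s_incr (N1 + N2).+1).
  by rewrite ltnS leq_addr.
have d2 : abs (path_average p a b f phi2 (t k) - L2) < abs (L1 - L2).
  apply: h2 => //; apply: leq_trans (growth t t_incr (N1 + N2).+1).
  by rewrite ltnS leq_addl.
have absN1 : abs (-1) = 1.
  have a1 : abs 1 = 1.
    have a1_neq0 : abs 1 != 0.
      by apply/eqP => /(Cp_abs_eq0 hK)/eqP; rewrite oner_eq0.
    by apply: (mulfI a1_neq0); rewrite -(Cp_absM hK) !mulr1.
  apply/eqP; rewrite -[_ == _](@eqrXn2 _ 2) ?(Cp_abs_ge0 hK) //.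
  by rewrite expr2 -(Cp_absM hK) mulrNN mulr1 a1 expr1n.
have : abs (L1 - L2) < abs (L1 - L2).
  pose A := path_average p a b f phi1 (s k).
  have AE : A = path_average p a b f phi2 (t k).
    by rewrite /A /path_average -s_eq t_eq.
  have {1}-> : L1 - L2 = (-1) * (A - L1) + (A - L2).
    by rewrite mulN1r opprB addrA subrK.
  apply: le_lt_trans (Cp_absD hK _ _) _.
  rewrite gt_max (Cp_absM hK) absN1 mul1r; apply/andP; split; first exact: d1.
  by rewrite AE; exact: d2.
by rewrite ltxx.
Qed.

(* Main.v *)
(** A Krasner analytic function on [D] is a uniform limit of linear combinations
    of polynomials and of [1 / (x - c)] with [c] outside [D] (double poles are
    limits of pairs of simple ones). For these the average over the [q]-th roots
    of unity is explicit: it vanishes on polynomials of degree less than [q - 1],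
    and equals [1 / (1 - u^q)] on [1 / (x - c)], where [u = (a - c) / (a - b)].
    If [c] is in the hole around [x_i] then [u] is close to the Teichmueller
    representative [w] of [(a - x_i) / (a - b)], so that [u^q - w^q] tends to 0
    for [q = p^(alpha + lambda k)]; taking for [lambda] a common period of the
    sequences [w^(p^k)] gives [w^q = w^(p^alpha)]. If [|c - a| > R] then
    [|u| > 1] and the average tends to 0.

    The limit passes to [f] although the averages have the large factor [1/q]:
    on analytic functions on the open disc [A(a, b)] they are bounded by [R] times
    the supremum norm, uniformly in [q], because the average of a polynomial in
    [zeta = (x - a) / (b - a)] is a sum of some of its coefficients. *)

Require Import Defs.
From HB Require Import structures.
From mathcomp Require Import all_boot all_order all_algebra all_solvable all_field.
From mathcomp Require Import boolp classical_sets functions cardinality fsbigop.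
From mathcomp Require Import reals.
From mathcomp Require Import zify ring lra.

Set Implicit Arguments.
Unset Strict Implicit.
Unset Printing Implicit Defensive.

Import Order.TTheory GRing.Theory Num.Theory.

Local Open Scope classical_set_scope.
Local Open Scope ring_scope.

(** [is_Cp] makes only the algebraic numbers inside K algebraically closed, while denominators have
    to split, and roots of unity and roots of p have to exist, in K itself. Algebraic closedness of
    K is therefore proved before anything else is done with rational functions.

    The conditions |b - a| = |b - x_i| = R enter through u = (a - x_i) / (a - b): they give |u| <= 1
    and |1 - u| = 1, so u is not congruent to 1. Since z -> z^p is injective modulo the maximal
    ideal, 1 - u^q keeps absolute value 1 for every q = p^m, and closeness of u^q and w^q passes to
    the inverses.

    The right-hand side must be continuous in f too. Cauchy's estimate on a circle around x_i shows
    that a residue changes by at most R times the change of f in supremum norm. As [residue] picks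
    some expansion, and is 0 when there is none, an expansion of f itself is first obtained as the
    limit of those of the approximants. *)

Section Cp.

Variables (RR : realType) (p : nat) (K : fieldType) (abs : K -> RR).
Hypotheses (p_prime : prime p) (p_odd : odd p) (K_Cp : is_Cp p abs).

(** * Ultrametric estimates *)

Lemma abs_ge0 x : 0 <= abs x. Proof. exact: Cp_abs_ge0 K_Cp x. Qed.

Lemma absM x y : abs (x * y) = abs x * abs y.
Proof. exact: Cp_absM K_Cp x y. Qed.

Lemma abs1 : abs 1 = 1.
Proof.
have a1_neq0 : abs 1 != 0.
  by apply/eqP => /(Cp_abs_eq0 K_Cp)/eqP; rewrite oner_eq0.
by apply: (mulfI a1_neq0); rewrite -absM !mulr1.
Qed.

Lemma absN x : abs (- x) = abs x.
Proof.
have absN1 : abs (-1) = 1.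
  apply/eqP; rewrite -[_ == _](@eqrXn2 _ 2) ?abs_ge0 //.
  by rewrite expr2 -absM mulrNN mulr1 abs1 expr1n.
by rewrite -mulN1r absM absN1 mul1r.
Qed.

Lemma absC x y : abs (x - y) = abs (y - x).
Proof. by rewrite -absN opprB. Qed.

Lemma absp_gt0 : 0 < abs p%:R.
Proof. by rewrite (Cp_abs_p K_Cp) invr_gt0 ltr0n prime_gt0. Qed.

Lemma absp_lt1 : abs p%:R < 1.
Proof. by rewrite (Cp_abs_p K_Cp) invf_lt1 ?ltr1n ?ltr0n ?prime_gt1 ?prime_gt0. Qed.

Lemma abs0 : abs 0 = 0.
Proof.
have /eqP := absM 0 p%:R; rewrite mul0r -subr_eq0 -{1}[abs 0]mulr1 -mulrBr mulf_eq0.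
by case/orP=> [/eqP//|]; rewrite subr_eq0 => /eqP h; have := absp_lt1; rewrite -h ltxx.
Qed.

Lemma abs_eq0 x : (abs x == 0) = (x == 0).
Proof.
by apply/eqP/eqP => [/(Cp_abs_eq0 K_Cp)//|->]; rewrite abs0.
Qed.

Lemma abs_gt0 x : (0 < abs x) = (x != 0).
Proof. by rewrite lt_neqAle abs_ge0 andbT eq_sym abs_eq0. Qed.

Lemma absX x n : abs (x ^+ n) = abs x ^+ n.
Proof. by elim: n => [|n IH]; rewrite ?abs1 // !exprS absM IH. Qed.

Lemma absV x : abs x^-1 = (abs x)^-1.
Proof.
have [->|x0] := eqVneq x 0; first by rewrite invr0 abs0 invr0.
have ax0 : abs x != 0 by rewrite abs_eq0.
by apply: (mulfI ax0); rewrite -absM !divff ?abs1.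
Qed.

Lemma abs_div x y : abs (x / y) = abs x / abs y.
Proof. by rewrite absM absV. Qed.

Lemma abs_prod (I : Type) (s : seq I) (F : I -> K) :
  abs (\prod_(i <- s) F i) = \prod_(i <- s) abs (F i).
Proof. by elim/big_rec2: _ => [|i y x _ <-]; rewrite ?abs1 ?absM. Qed.

Lemma absD_le x y c : abs x <= c -> abs y <= c -> abs (x + y) <= c.
Proof. by move=> hx hy; apply: le_trans (Cp_absD K_Cp _ _) _; rewrite ge_max hx. Qed.

Lemma absD_lt x y c : abs x < c -> abs y < c -> abs (x + y) < c.
Proof. by move=> hx hy; apply: le_lt_trans (Cp_absD K_Cp _ _) _; rewrite gt_max hx. Qed.

Lemma absB_le x y c : abs x <= c -> abs y <= c -> abs (x - y) <= c.
Proof. by move=> hx hy; apply: absD_le; rewrite ?absN. Qed.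

Lemma absB_lt x y c : abs x < c -> abs y < c -> abs (x - y) < c.
Proof. by move=> hx hy; apply: absD_lt; rewrite ?absN. Qed.

Lemma abs_trans_le y x z c : abs (x - y) <= c -> abs (y - z) <= c -> abs (x - z) <= c.
Proof. by move=> hx hy; rewrite -(subrK y x) -addrA; apply: absD_le. Qed.

Lemma abs_trans_lt y x z c : abs (x - y) < c -> abs (y - z) < c -> abs (x - z) < c.
Proof. by move=> hx hy; rewrite -(subrK y x) -addrA; apply: absD_lt. Qed.

Lemma abs_sum_le (I : Type) (s : seq I) (P : pred I) (F : I -> K) c : 0 <= c ->
  (forall i, P i -> abs (F i) <= c) -> abs (\sum_(i <- s | P i) F i) <= c.
Proof.
by move=> c0 h; elim/big_rec: _ => [|i x Pi hx]; rewrite ?abs0 // absD_le ?h.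
Qed.

Lemma abs_sum_lt (I : Type) (s : seq I) (P : pred I) (F : I -> K) c : 0 < c ->
  (forall i, P i -> abs (F i) < c) -> abs (\sum_(i <- s | P i) F i) < c.
Proof.
by move=> c0 h; elim/big_rec: _ => [|i x Pi hx]; rewrite ?abs0 // absD_lt ?h.
Qed.

Lemma abs_isosceles x y : abs (x - y) < abs y -> abs x = abs y.
Proof.
move=> h; apply/eqP; rewrite eq_le -{1}(subrK y x) absD_le ?(ltW h) //=.
rewrite leNgt; apply/negP => xy.
by have := absB_lt xy h; rewrite opprB addrC subrK ltxx.
Qed.

Lemma abs_nat_le1 n : abs n%:R <= 1.
Proof. by elim: n => [|n IH]; rewrite ?abs0 ?ler01 // -addn1 natrD absD_le ?abs1. Qed.

Lemma abs_int_le1 n : abs n%:~R <= 1.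
Proof. by case: n => n; rewrite ?NegzE ?mulrNz ?absN abs_nat_le1. Qed.

Lemma abs_dvd_le n : (p %| n)%N -> abs n%:R <= abs p%:R.
Proof.
by case/dvdnP=> m ->; rewrite natrM absM ler_piMl ?abs_ge0 // abs_nat_le1.
Qed.

(** By Bezout 1 is a combination of p and n with natural coefficients; if |n| < 1, it would have
    absolute value less than 1. *)
Lemma abs_coprime n : coprime n p -> abs n%:R = 1.
Proof.
rewrite coprime_sym => np; apply/eqP; rewrite eq_le abs_nat_le1 leNgt; apply/negP => n1.
have p0 : (0 < p)%N by rewrite prime_gt0.
have [km kn e _] := egcdnP n p0.
have : abs 1 < 1.
  have -> : 1 = km%:R * p%:R - kn%:R * n%:R :> K.
    by rewrite -!natrM e natrD (eqnP np) addrAC subrr add0r.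
  apply: absB_lt; rewrite absM.
    by apply: le_lt_trans absp_lt1; rewrite ler_piMl ?abs_ge0 ?abs_nat_le1.
  by apply: le_lt_trans n1; rewrite ler_piMl ?abs_ge0 ?abs_nat_le1.
by rewrite abs1 ltxx.
Qed.

(** Characteristic zero comes from the absolute value: the p-part of n is a power of p, with |p| >
    0, and the rest has absolute value 1. *)
Lemma natr_neq0 n : (0 < n)%N -> n%:R != 0 :> K.
Proof.
move=> n0; rewrite -abs_eq0 -(partnC p n0) natrM absM mulf_eq0 negb_or.
rewrite [X in _ && X](_ : _ = true) ?andbT; last first.
  rewrite abs_coprime ?oner_eq0 // coprime_sym.
  by rewrite (pnat_coprime (pnat_id p_prime)) ?part_pnat.
by rewrite p_part natrX absX expf_neq0 // gt_eqF ?absp_gt0.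
Qed.

Lemma expr_lt_eps (t e : RR) : 0 <= t < 1 -> 0 < e ->
  exists N, forall n, (N <= n)%N -> t ^+ n < e.
Proof.
move=> /andP[t0 t1] e0; have [->|tn0] := eqVneq t 0.
  by exists 1%N => -[//|n _]; rewrite exprS mul0r.
have tp : 0 < t by rewrite lt_neqAle eq_sym tn0.
pose s := t^-1 - 1; have s0 : 0 < s by rewrite subr_gt0 invf_gt1.
have bern n : 1 + s *+ n <= t^-1 ^+ n.
  elim: n => [|n IH]; first by rewrite mulr0n addr0.
  have tE : t^-1 = 1 + s by rewrite /s addrC subrK.
  rewrite exprS; move: IH; rewrite !tE => IH.
  apply: le_trans (_ : (1 + s) * (1 + s *+ n) <= _).
    rewrite mulrS mulrDl mul1r mulrDr mulr1.
    have := mulr_ge0 (ltW s0) (mulrn_wge0 n (ltW s0)); lra.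
  by rewrite ler_pM2l // ltr_wpDl.
pose N := Num.truncn (e^-1 / s); exists N.+1 => n Nn.
rewrite -[t]invrK exprVn invf_plt ?posrE ?exprn_gt0 ?invr_gt0 //.
apply: lt_le_trans (bern n).
have : e^-1 / s < n%:R.
  have := truncnS_gt (e^-1 / s); rewrite -/N => h; apply: lt_le_trans h _.
  by rewrite ler_nat.
by rewrite ltr_pdivrMr // mulrC mulr_natr => h; apply: lt_trans h _; rewrite ltrDr.
Qed.

Lemma exists_abs_lt (e : RR) : 0 < e -> exists2 z : K, z != 0 & abs z < e.
Proof.
move=> e0; have [|N h] := @expr_lt_eps (abs p%:R) e _ e0.
  by rewrite abs_ge0 absp_lt1.
exists (p%:R ^+ N); first by rewrite expf_neq0 // natr_neq0 ?prime_gt0.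
by rewrite absX h.
Qed.

(** * [C_p] is algebraically closed *)

Lemma abs_le_eps_eq0 x : (forall e : RR, 0 < e -> abs x <= e) -> x = 0.
Proof.
move=> h; apply/eqP/negPn/negP; rewrite -abs_gt0 => x0.
have := h (abs x / 2) (divr_gt0 x0 (ltr0n _ 2)); lra.
Qed.

Lemma coef_bound (P : {poly K}) : exists2 C : RR, 1 <= C & forall i, abs P`_i <= C.
Proof.
exists (1 + \sum_(i < size P) abs P`_i).
  by rewrite lerDl sumr_ge0 // => i _; apply: abs_ge0.
move=> i; have [iP|iP] := ltnP i (size P); last first.
  by rewrite nth_default // abs0 addr_ge0 ?sumr_ge0 // => j _; apply: abs_ge0.
rewrite (bigD1 (Ordinal iP)) //= addrCA lerDl addr_ge0 ?sumr_ge0 // => j _.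
exact: abs_ge0.
Qed.

Lemma horner_bound (P : {poly K}) (e B : RR) (d : nat) x :
  0 <= e -> 1 <= B -> (size P <= d.+1)%N -> (forall i, abs P`_i <= e) ->
  abs x <= B -> abs P.[x] <= e * B ^+ d.
Proof.
move=> e0 B1 sP hP xB; have B0 : 0 <= B by apply: le_trans B1.
rewrite horner_coef; apply: abs_sum_le => [|i _]; first by rewrite mulr_ge0 ?exprn_ge0.
rewrite absM absX ler_pM ?exprn_ge0 ?abs_ge0 //.
apply: le_trans (_ : B ^+ i <= _); first by rewrite lerXn2r ?nnegrE ?abs_ge0.
by rewrite ler_weXn2l // -ltnS (leq_trans (ltn_ord i)).
Qed.

(** For |x| > B the leading term dominates: x^d equals minus the sum of the lower terms, which gives
    |x|^d <= B |x|^(d-1). *)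
Lemma root_bound (P : {poly K}) (B : RR) x :
  P \is monic -> 1 <= B -> (forall i, abs P`_i <= B) -> root P x -> abs x <= B.
Proof.
move=> Pm B1 hP rx; rewrite leNgt; apply/negP => Bx.
have B0 : 0 < B by apply: lt_le_trans B1.
have sP : (size P).-1.+1 = size P by rewrite prednK // lt0n size_poly_eq0 monic_neq0.
case: (posnP (size P).-1) => [d0|]; last move/prednK.
  have /size_poly1P [c c0 Pc] : size P == 1%N by rewrite -sP d0.
  by move: rx; rewrite Pc rootC (negPf c0).
move: rx; rewrite /root horner_coef -sP big_ord_recr /= -[P`_ _]/(lead_coef P).
rewrite (monicP Pm) mul1r; set d := _.-1; set e := d.-1 => + dE.
rewrite addr_eq0 => /eqP h.
have : abs (x ^+ d) <= B * abs x ^+ e.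
  rewrite -absN -h; apply: abs_sum_le => [|i _].
    by rewrite mulr_ge0 ?exprn_ge0 ?abs_ge0 ?ltW.
  rewrite absM absX ler_pM ?exprn_ge0 ?abs_ge0 // ler_weXn2l //.
    by apply: le_trans (ltW Bx).
  by rewrite -ltnS dE ltn_ord.
rewrite absX -dE exprS ler_pM2r ?exprn_gt0 ?(lt_trans B0) //.
by rewrite leNgt Bx.
Qed.

(** The value at x is the product of the distances to the roots, so one factor must be less than t.
    This stands in for Hensel's lemma. *)
Lemma near_root (rs : seq K) (t : RR) x : 0 <= t ->
  abs (\prod_(z <- rs) ('X - z%:P)).[x] < t ^+ size rs ->
  exists2 z, z \in rs & abs (x - z) < t.
Proof.
move=> t0; rewrite horner_prod abs_prod => h.
have [/hasP[z zr zt]|/hasPn hn] := boolP (has (fun z => abs (x - z) < t) rs).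
  by exists z.
move: h; rewrite ltNge => /negP[].
elim: rs hn => [|z rs IH] hn; first by rewrite big_nil.
rewrite big_cons /= exprS ler_pM ?exprn_ge0 ?IH //.
  by have := hn z (mem_head _ _); rewrite -leNgt !hornerE.
by move=> y yr; apply: hn; rewrite inE yr orbT.
Qed.

Lemma in_Qp_int n : in_Qp abs n%:~R.
Proof. by move=> e e0; exists n%:~R; rewrite ratr_int subrr abs0. Qed.

Lemma in_Qp_Qpbar x : in_Qp abs x -> in_Qp abs (- x) -> in_Qpbar abs x.
Proof.
move=> hx hNx; exists ('X - x%:P); split; rewrite ?polyXsubC_eq0 ?root_XsubC //.
move=> i; rewrite coefB coefX coefC; case: i => [|[|i]] /=.
- by rewrite sub0r.
- by rewrite subr0; apply: (in_Qp_int 1).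
- by rewrite subr0; apply: (in_Qp_int 0).
Qed.

Lemma in_Qpbar_int n : in_Qpbar abs n%:~R.
Proof. by apply: in_Qp_Qpbar; rewrite -?mulrNz; apply: in_Qp_int. Qed.

Lemma monic_Qpbar_approx (P : {poly K}) (e : RR) : P \is monic -> 0 < e ->
  exists Q : {poly K}, [/\ Q \is monic, size Q = size P,
    forall i, in_Qpbar abs Q`_i & forall i, abs (P`_i - Q`_i) <= e].
Proof.
move=> Pm e0; have sP : (size P).-1.+1 = size P.
  by rewrite prednK // lt0n size_poly_eq0 monic_neq0.
have /choice [q hq] : forall i, exists y, in_Qpbar abs y /\ abs (P`_i - y) <= e.
  by move=> i; have [y y1 y2] := Cp_Qpbar_dense K_Cp P`_i e0; exists y; split=> //; apply: ltW.
(* The leading coefficient is set to 1, not approximated, so that Q is monic of the same degree. *)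
pose d := (size P).-1; pose Q := \poly_(i < d.+1) (if i == d then 1 else q i).
have sQ : size Q = d.+1 by rewrite size_poly_eq // eqxx oner_eq0.
exists Q; rewrite -sP -/d; split=> //.
- by apply/monicP; rewrite /lead_coef sQ /= coef_poly ltnSn eqxx.
- move=> i; rewrite coef_poly; case: ifP => _; last exact: (in_Qpbar_int 0).
  by case: ifP => _; [exact: (in_Qpbar_int 1) | case: (hq i)].
- move=> i; rewrite coef_poly; case: ltnP => [|di].
    case: eqP => [-> _|_ _]; last by case: (hq i).
    by rewrite -[P`_ _]/(lead_coef P) (monicP Pm) subrr abs0 ltW.
  by rewrite nth_default ?subr0 ?abs0 ?ltW // -sP.
Qed.

Lemma cauchy_seq_geometric (u : nat -> K) :
  (forall n, abs (u n - u n.+1) <= abs p%:R ^+ n) -> cauchy_seq abs u.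
Proof.
move=> hu e e0; have [|N hN] := @expr_lt_eps (abs p%:R) e _ e0.
  by rewrite abs_ge0 absp_lt1.
have hk k : abs (u N - u (N + k)%N) <= abs p%:R ^+ N.
  elim: k => [|k IH]; first by rewrite addn0 subrr abs0 exprn_ge0 ?abs_ge0.
  apply: abs_trans_le IH _; rewrite addnS; apply: le_trans (hu _) _.
  by rewrite ler_wiXn2l ?abs_ge0 ?(ltW absp_lt1) ?leq_addr.
exists N => m n /subnKC <- /subnKC <-; apply: (@abs_trans_lt (u N)).
  by rewrite absC; apply: le_lt_trans (hk _) (hN _ _).
exact: le_lt_trans (hk _) (hN _ _).
Qed.

(* An approximant of [P] over the algebraic numbers has one root by hypothesis,
   and splits because its quotient by the corresponding factor is covered by the
   induction hypothesis. Successive approximants then have close roots, which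
   converge to a root of [P]. *)
Lemma monic_split (P : {poly K}) : P \is monic ->
  exists rs : seq K, P = \prod_(z <- rs) ('X - z%:P).
Proof.
move: {2}(size P) (leqnn (size P)) => n; elim: n P => [|n IH] P sPn Pm.
  by move: sPn; rewrite leqn0 size_poly_eq0 (negPf (monic_neq0 Pm)).
have [sP1|sP] := leqP (size P) 1.
  exists [::]; rewrite big_nil; have := monicP Pm.
  by rewrite (size1_polyC sP1) lead_coefC => ->.
have deflate (Q : {poly K}) x : Q \is monic -> (size Q <= n.+1)%N -> root Q x ->
    exists rs : seq K, Q = \prod_(z <- rs) ('X - z%:P).
  move=> Qm sQ /factor_theorem [q Qq].
  have qm : q \is monic by move: Qm; rewrite Qq monicMr ?monicXsubC.
  have [|rs rsE] := IH q _ qm; last by exists (rcons rs x); rewrite Qq rsE -cats1 big_cat big_seq1.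
  by move: sQ; rewrite Qq size_Mmonic ?monicXsubC ?monic_neq0 // size_XsubC addn2.
suff [x rx] : exists x, root P x by apply: deflate rx.
have [B B1 hB] := coef_bound P; have B0 : 0 < B by apply: lt_le_trans B1.
pose d := (size P).-1; have sPd : size P = d.+1 by rewrite /d prednK // ltnW.
have d0 : (0 < d)%N by rewrite -ltnS -sPd.
(* At a root of [Q k], which is bounded by B, the value of [Q k.+1] is at most e_k B^d =
   |p|^((k+1)d). This is less than |p|^(kd), as [near_root] requires to give a root at distance less
   than |p|^k. *)
pose e k : RR := (abs p%:R ^+ k.+1 / B) ^+ d.
have e0 k : 0 < e k by rewrite exprn_gt0 ?divr_gt0 ?exprn_gt0 ?absp_gt0.
have pk1 k : abs p%:R ^+ k <= 1 by rewrite exprn_ile1 ?abs_ge0 ?(ltW absp_lt1).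
have eB k : e k * B ^+ d = (abs p%:R ^+ k.+1) ^+ d.
  by rewrite /e expr_div_n divfK ?expf_neq0 ?gt_eqF.
have e1 k : e k <= 1.
  have pB0 : 0 <= abs p%:R ^+ k.+1 / B by rewrite divr_ge0 ?exprn_ge0 ?abs_ge0 ?(ltW B0).
  apply: exprn_ile1 => //.
  by rewrite ler_pdivrMr // mul1r (le_trans (pk1 k.+1)).
have ele k : e k.+1 <= e k.
  have pB0 j : 0 <= abs p%:R ^+ j / B by rewrite divr_ge0 ?exprn_ge0 ?abs_ge0 ?(ltW B0).
  rewrite lerXn2r ?nnegrE //.
  by rewrite ler_pM2r ?invr_gt0 // ler_wiXn2l ?abs_ge0 ?(ltW absp_lt1).
have /choice [Q hQ] : forall k, exists Q : {poly K}, [/\ Q \is monic, size Q = size P,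
    forall i, in_Qpbar abs Q`_i & forall i, abs (P`_i - Q`_i) <= e k].
  by move=> k; apply: monic_Qpbar_approx.
have Qroot k x : root (Q k) x -> abs x <= B.
  have [Qm _ _ QP] := hQ k; apply: root_bound => // i.
  by rewrite -[_`_i](subKr P`_i) absB_le // (le_trans (QP i)) // (le_trans (e1 k)).
have Qex k : exists x, root (Q k) x.
  have [Qm sQ Qq _] := hQ k; have [|x _ rx] := Cp_Qpbar_closed K_Cp Qq.
    by rewrite sQ.
  by exists x.
have Qsplit k : exists rs : seq K, Q k = \prod_(z <- rs) ('X - z%:P).
  by have [Qm sQ _ _] := hQ k; have [x rx] := Qex k; apply: deflate rx; rewrite ?sQ.
(* The premise sits inside the existential so that [choice] yields a total function; 0 is a dummy
   for points that are not roots. *)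
have next (kx : nat * K) : exists y, root (Q kx.1) kx.2 ->
    root (Q kx.1.+1) y /\ abs (kx.2 - y) <= abs p%:R ^+ kx.1.
  case: kx => k x /=; have [rx|nrx] := boolP (root (Q k) x); last by exists 0.
  have [rs rsE] := Qsplit k.+1; have [_ sQ _ QP] := hQ k.+1; have [_ sQ' _ QP'] := hQ k.
  have srs : size rs = d by move: sQ; rewrite rsE size_prod_XsubC sPd => -[].
  have [|| y yr xy] := @near_root rs (abs p%:R ^+ k) x.
  - by rewrite exprn_ge0 ?abs_ge0.
  - have : e k * B ^+ d < (abs p%:R ^+ k) ^+ d.
      rewrite eB ltrXn2r -?lt0n ?d0 ?exprn_ge0 ?abs_ge0 //.
      by rewrite exprS gtr_pMl ?exprn_gt0 ?absp_gt0 ?absp_lt1.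
    rewrite -rsE srs -[_.[x]]subr0 -(eqP rx) -hornerN -hornerD; apply: le_lt_trans.
    apply: horner_bound (ltW (e0 k)) B1 _ _ (Qroot _ _ rx).
      by rewrite -sPd (leq_trans (size_polyD _ _)) // size_polyN sQ sQ' maxnn.
    move=> i; rewrite coefB; apply: (@abs_trans_le P`_i) => //.
    by rewrite absC (le_trans (QP i)).
  by exists y; rewrite rsE root_prod_XsubC (ltW xy).
have [g hg] := choice next; have [x0 rx0] := Qex 0%N.
pose u := fix u k := if k is k'.+1 then g (k', u k') else x0.
have ru k : root (Q k) (u k) by elim: k => //= k rk; case: (hg (k, u k) rk).
have [l ul] : exists l, seq_lim abs u l.
  by apply: (Cp_complete K_Cp); apply: cauchy_seq_geometric => k; case: (hg (k, u k) (ru k)).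
exists l; apply/eqP; apply: abs_le_eps_eq0 => t t0.
have [q Pq] : exists q, P - P.[l]%:P = q * ('X - l%:P).
  by apply/factor_theorem; rewrite /root !hornerE subrr.
have [C C1 hC] := coef_bound q; have C0 : 0 < C by apply: lt_le_trans C1.
have CB : 0 < C * B ^+ size q by rewrite mulr_gt0 ?exprn_gt0.
have [N1 hN1] := ul _ (divr_gt0 t0 CB).
have [|N2 hN2] := @expr_lt_eps (abs p%:R) t _ t0; first by rewrite abs_ge0 absp_lt1.
pose k := (N1 + N2)%N; have [_ sQ _ QP] := hQ k.
(* From P - P(l) = q (X - l), evaluated at the root u_k of [Q k]. The first term is small since the
   coefficients are close, the second since u_k tends to l. *)
have -> : P.[l] = (P - Q k).[u k] - q.[u k] * (u k - l).
  have := congr1 (fun r => r.[u k]) Pq; rewrite !hornerE => <-.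
  by rewrite (eqP (ru k)) subr0 opprB addrCA subrr addr0.
apply: absB_le.
  apply: le_trans (_ : e k * B ^+ d <= _).
    apply: horner_bound (ltW (e0 k)) B1 _ _ (Qroot _ _ (ru k)).
      by rewrite -sPd (leq_trans (size_polyD _ _)) // size_polyN sQ maxnn.
    by move=> i; rewrite coefB.
  rewrite eB -exprM ltW // hN2 //.
  by rewrite (leq_trans (leq_addl N1.+1 N2)) // leq_pmulr.
rewrite absM; apply: le_trans (_ : C * B ^+ size q * (t / (C * B ^+ size q)) <= _).
  apply: ler_pM; rewrite ?abs_ge0 //; last by rewrite ltW ?hN1 ?leq_addr.
  by apply: horner_bound (ltW C0) B1 _ hC (Qroot _ _ (ru k)).
by rewrite mulrC divfK ?gt_eqF.
Qed.

Lemma poly_split (P : {poly K}) : P != 0 ->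
  exists rs : seq K, P = lead_coef P *: \prod_(z <- rs) ('X - z%:P).
Proof.
move=> P0; have c0 : lead_coef P != 0 by rewrite lead_coef_eq0.
have [|rs rsE] := @monic_split ((lead_coef P)^-1 *: P).
  by apply/monicP; rewrite lead_coefZ mulVf.
by exists rs; rewrite -rsE scalerA divff // scale1r.
Qed.

(** * Roots of unity and coefficient estimates *)

Lemma unity_prod n : (0 < n)%N ->
  exists2 rs : seq K, size rs = n & 'X^n - 1 = \prod_(z <- rs) ('X - z%:P).
Proof.
move=> n0; have [|rs rsE] := @monic_split ('X^n - 1); first by rewrite -polyC1 monicXnsubC.
exists rs => //; have := congr1 (size \o polyseq) rsE.
by rewrite /= size_prod_XsubC -polyC1 size_XnsubC // => -[].
Qed.

Lemma ex_prim_root n : (0 < n)%N -> exists w : K, n.-primitive_root w.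
Proof.
move=> n0; have [rs srs rsE] := unity_prod n0.
have urs : uniq rs.
  by rewrite -separable_prod_XsubC -rsE separable_Xn_sub_1 // natr_neq0.
have : has n.-primitive_root rs.
  rewrite has_prim_root ?srs //; apply/allP => z zrs.
  by rewrite /root_of_unity rsE root_prod_XsubC.
by case/hasP=> w _ hw; exists w.
Qed.

Lemma ex_nth_root n (c : K) : (0 < n)%N -> exists y, y ^+ n = c.
Proof.
move=> n0; have [|[|y rs] rsE] := @monic_split ('X^n - c%:P).
- by rewrite monicXnsubC.
- have := congr1 (size \o polyseq) rsE.
  by rewrite /= big_nil size_XnsubC // size_poly1 => -[n1]; rewrite n1 in n0.
exists y; have : root ('X^n - c%:P) y by rewrite rsE root_prod_XsubC mem_head.
by rewrite /root !hornerE subr_eq0 => /eqP.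
Qed.

Lemma abs_expr_eq1 z n : (0 < n)%N -> abs (z ^+ n) = 1 -> abs z = 1.
Proof. by move=> n0; rewrite absX => /eqP; rewrite pexpr_eq1 ?abs_ge0 // => /eqP. Qed.

Lemma abs_prim_root n w : n.-primitive_root w -> abs w = 1.
Proof.
move=> wn; apply: (@abs_expr_eq1 _ n (prim_order_gt0 wn)).
by rewrite (prim_expr_order wn) abs1.
Qed.

Lemma sum_prim_root n w j : n.-primitive_root w ->
  \sum_(i < n) (w ^+ i) ^+ j = if (n %| j)%N then n%:R else 0 :> K.
Proof.
move=> wn; case: ifPn => nj.
  rewrite (eq_bigr (fun=> 1)) ?sumr_const ?card_ord // => i _.
  by rewrite exprAC (eqP (_ : w ^+ j == 1)) ?expr1n // -(prim_order_dvd wn).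
have wj1 : w ^+ j - 1 != 0 by rewrite subr_eq0 -(prim_order_dvd wn).
apply: (mulfI wj1); rewrite mulr0.
under eq_bigr do rewrite exprAC.
by rewrite -subrX1 exprAC (prim_expr_order wn) expr1n subrr.
Qed.

(** A coefficient is a Fourier average of the values at N-th roots of unity. With N prime to p, the
    division by N leaves absolute values unchanged. *)
Lemma coef_le_circle (P : {poly K}) c :
  (forall z, abs z = 1 -> abs P.[z] <= c) -> forall n, abs P`_n <= c.
Proof.
move=> hP n; have c0 : 0 <= c by apply: le_trans (hP 1 abs1); apply: abs_ge0.
have [nP|nP] := leqP (size P) n; first by rewrite nth_default // abs0.
(* Congruent to 1 modulo p, hence |N| = 1, and larger than the degree, so that no two exponents of P
   agree modulo N. *)
pose N := (p * size P).+1; have [//|w wN] := @ex_prim_root N.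
have sN : (size P < N)%N by rewrite ltnS leq_pmull ?prime_gt0.
have NnE : \sum_(i < N) (w ^+ i) ^+ (N - n) * P.[w ^+ i] = N%:R * P`_n.
  under eq_bigr do rewrite horner_coef mulr_sumr.
  rewrite exchange_big /= (bigD1 (Ordinal nP)) //= [X in _ + X]big1 ?addr0.
    rewrite [RHS](_ : _ = P`_n * \sum_(i < N) (w ^+ i) ^+ N).
      rewrite mulr_sumr; apply: eq_bigr => i _; rewrite mulrCA -exprD subnK //.
      by rewrite ltnW // (ltn_trans nP).
    by rewrite (sum_prim_root _ wN) dvdnn mulrC.
  move=> m mn; under eq_bigr do rewrite mulrCA -exprD.
  rewrite -mulr_sumr (sum_prim_root _ wN); case: ifP => [/dvdnP[k kE]|_]; last by rewrite mulr0.
  case/negP: mn; apply/eqP/val_inj => /=; have := ltn_ord m.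
  move: (N) kE nP sN => N0; case: k => [|[|k]]; rewrite ?mulSn; [lia|lia|].
  by move: (k * N0)%N (size P) (nat_of_ord m) => t s m0; clear; lia.
have : abs (N%:R * P`_n) <= c.
  rewrite -NnE; apply: abs_sum_le => // i _.
  have wi : abs (w ^+ i) = 1 by rewrite absX (abs_prim_root wN) expr1n.
  by rewrite absM absX wi expr1n mul1r hP.
by rewrite absM abs_coprime ?mul1r // /N -addn1 mulnC -coprime_modl modnMDl coprime_modl coprime1n.
Qed.

Lemma coefM_le (P Q : {poly K}) c d : 0 <= c ->
  (forall i, abs P`_i <= c) -> (forall i, abs Q`_i <= d) ->
  forall i, abs (P * Q)`_i <= c * d.
Proof.
move=> c0 hP hQ i; have d0 : 0 <= d := le_trans (abs_ge0 _) (hQ 0%N).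
rewrite coefM; apply: abs_sum_le => [|j _]; first by rewrite mulr_ge0.
by rewrite absM ler_pM ?abs_ge0.
Qed.

Lemma coefX_le1 (P : {poly K}) n :
  (forall i, abs P`_i <= 1) -> forall i, abs (P ^+ n)`_i <= 1.
Proof.
move=> hP; elim: n => [|n IH] i.
  by rewrite coef1; case: eqP; rewrite ?abs1 ?abs0 ?ler01.
by rewrite exprS -[1]mulr1; apply: coefM_le; rewrite ?ler01.
Qed.

Lemma coef_comp_le (P Q : {poly K}) c :
  (forall i, abs P`_i <= c) -> (forall i, abs Q`_i <= 1) ->
  forall i, abs (P \Po Q)`_i <= c.
Proof.
move=> hP hQ i; have c0 : 0 <= c := le_trans (abs_ge0 _) (hP 0%N).
rewrite comp_polyE coef_sum; apply: abs_sum_le => // j _.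
by rewrite coefZ absM -[c]mulr1 ler_pM ?abs_ge0 // coefX_le1.
Qed.

(* The bound on a circle of radius [rho < 1] only gives [|P_n| rho^n <= c];
   the radii [p^(-1/m)] are available and tend to 1. *)
Lemma coef_le_odisc (P : {poly K}) c :
  (forall z, abs (z - 1) < 1 -> abs P.[z] <= c) -> forall n, abs P`_n <= c.
Proof.
move=> hP; have c0 : 0 <= c.
  by apply: le_trans (hP 1 _); rewrite ?abs_ge0 // subrr abs0.
have hX i : abs ('X - 1 : {poly K})`_i <= 1.
  by rewrite coefB coefX coef1 absB_le //; case: eqP; rewrite ?abs1 ?abs0 ?ler01.
(* The disc is recentred at 0; going back substitutes X - 1, whose coefficients are integral, so a
   bound on the coefficients survives. *)
pose Q := P \Po ('X + 1).
have -> : P = Q \Po ('X - 1).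
  by rewrite /Q -comp_polyA comp_polyD comp_polyX comp_polyC subrK comp_polyXr.
apply: coef_comp_le => // n {hX}.
(* The estimate |Q_n| |y|^n <= c on the circle through an m-th root y of p, raised to the power m.
   If |Q_n| > c, then (c / |Q_n|)^m tends to 0 with m, whereas it is at least |p|^n. *)
have hQ m : (0 < m)%N -> abs Q`_n ^+ m * abs p%:R ^+ n <= c ^+ m.
  move=> m0; have [y ym] := ex_nth_root p%:R m0.
  have y1 : abs y < 1.
    rewrite ltNge; apply/negP => y1; have := exprn_ege1 m y1.
    by rewrite -absX ym leNgt absp_lt1.
  rewrite -ym absX exprAC -exprMn lerXn2r ?nnegrE ?mulr_ge0 ?exprn_ge0 ?abs_ge0 //.
  have [nQ|nQ] := leqP (size Q) n; first by rewrite nth_default ?abs0 ?mul0r.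
  pose S := \poly_(i < size Q) (Q`_i * y ^+ i).
  have -> : abs Q`_n * abs y ^+ n = abs S`_n by rewrite coef_poly nQ absM absX.
  apply: coef_le_circle => z z1.
  have -> : S.[z] = Q.[y * z].
    rewrite horner_poly horner_coef; apply: eq_bigr => i _.
    by rewrite exprMn mulrA.
  by rewrite /Q horner_comp !hornerE hP // addrK absM z1 mulr1.
rewrite leNgt; apply/negP => cQ.
have Q0 : 0 < abs Q`_n by apply: le_lt_trans cQ.
have [||m hm] := @expr_lt_eps (c / abs Q`_n) (abs p%:R ^+ n).
- by rewrite divr_ge0 ?abs_ge0 //= ltr_pdivrMr // mul1r.
- by rewrite exprn_gt0 ?absp_gt0.
have := hQ m.+1 isT; have := hm m.+1 (leqnSn m).
rewrite expr_div_n ltr_pdivrMr ?exprn_gt0 // mulrC => h1 h2.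
by have := lt_le_trans h1 h2; rewrite ltxx.
Qed.

(** * The Teichmueller character *)

Lemma abs_expr_sub_le x y n c : abs x <= 1 -> abs y <= 1 -> abs (x - y) <= c ->
  abs (x ^+ n - y ^+ n) <= c.
Proof.
move=> x1 y1 xy; rewrite subrXX absM -[c]mulr1 ler_pM ?abs_ge0 //.
apply: abs_sum_le => // i _; rewrite absM !absX.
by rewrite mulr_ile1 ?exprn_ge0 ?exprn_ile1 ?abs_ge0.
Qed.

(** Frobenius is injective on the residue field: (x - y)^p differs from x^p - y^p by terms with
    binomial coefficients divisible by p. As p is odd, the last term of the expansion is -y^p. *)
Lemma abs_subXp_lt1 x y : abs x <= 1 -> abs y <= 1 ->
  abs (x ^+ p - y ^+ p) < 1 -> abs (x - y) < 1.
Proof.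
move=> x1 y1 xy; rewrite ltNge; apply/negP => /(exprn_ege1 p).
rewrite -absX leNgt => /negP; apply.
have -> : (x - y) ^+ p = (x ^+ p - y ^+ p) + ((x - y) ^+ p - (x ^+ p - y ^+ p)).
  by rewrite addrCA subrr addr0.
apply: absD_lt xy _; apply: le_lt_trans absp_lt1.
have -> : (x - y) ^+ p - (x ^+ p - y ^+ p) = \sum_(i < p.-1)
    ((-1) ^+ i.+1 * x ^+ (p - i.+1) * y ^+ i.+1) *+ 'C(p, i.+1).
  rewrite exprBn; case: (p) p_odd => [//|q] q_odd; rewrite big_ord_recl big_ord_recr /=.
  rewrite bin0 binn subn0 subnn !expr0 mulr1 mul1r !mulr1n mulr1.
  rewrite -signr_odd q_odd expr1 mulN1r; set S := \sum_(i < q) _.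
  transitivity S; first by move: (x ^+ _) (y ^+ _) S => ? ? ?; ring.
  by apply: eq_bigr => i _; rewrite /bump leq0n add1n.
apply: abs_sum_le => [|i _]; first exact: abs_ge0.
rewrite -[_ *+ _]mulr_natr absM -[leRHS]mul1r ler_pM ?abs_ge0 //; last first.
  apply: abs_dvd_le; rewrite prime_dvd_bin //=.
  by rewrite -[X in (_ < X)%N](@prednK p) ?prime_gt0 // ltnS.
rewrite !absM !absX absN abs1 expr1n mul1r mulr_ile1 ?exprn_ge0 ?abs_ge0 //.
  by rewrite exprn_ile1 ?abs_ge0.
by rewrite exprn_ile1 ?abs_ge0.
Qed.

Lemma abs_subXpn_lt1 x y n : abs x <= 1 -> abs y <= 1 ->
  abs (x ^+ (p ^ n) - y ^+ (p ^ n)) < 1 -> abs (x - y) < 1.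
Proof.
elim: n x y => [|n IH] x y x1 y1; first by rewrite !expr1.
rewrite expnS !exprM => /IH h; apply: abs_subXp_lt1 => //.
by apply: h; rewrite absX exprn_ile1 ?abs_ge0.
Qed.

(** The cofactor of x - y in x^p - y^p is p y^(p-1) up to terms divisible by differences of powers
    of x and y, so it is bounded by t. Thus p-th powers contract distances. *)
Lemma abs_subXp_le x y (t : RR) : abs x <= 1 -> abs y <= 1 -> abs (x - y) <= t ->
  abs p%:R <= t -> abs (x ^+ p - y ^+ p) <= abs (x - y) * t.
Proof.
move=> x1 y1 xy pt; rewrite subrXX absM ler_wpM2l ?abs_ge0 //.
have -> : \sum_(i < p) x ^+ (p.-1 - i) * y ^+ i =
    \sum_(i < p) (x ^+ (p.-1 - i) - y ^+ (p.-1 - i)) * y ^+ i + p%:R * y ^+ p.-1.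
  have -> : p%:R * y ^+ p.-1 = \sum_(i < p) y ^+ p.-1.
    by rewrite sumr_const card_ord mulr_natl.
  rewrite -big_split /=; apply: eq_bigr => i _.
  by rewrite mulrBl -exprD subnK ?subrK // -ltnS prednK ?prime_gt0.
have t0 : 0 <= t by apply: le_trans xy; apply: abs_ge0.
apply: absD_le; last first.
  by rewrite absM -[t]mulr1 ler_pM ?abs_ge0 // absX exprn_ile1 ?abs_ge0.
apply: abs_sum_le => // i _; rewrite absM -[t]mulr1 ler_pM ?abs_ge0 //.
  exact: abs_expr_sub_le.
by rewrite absX exprn_ile1 ?abs_ge0.
Qed.

Lemma abs_subXpn_le x y (t : RR) n : abs x <= 1 -> abs y <= 1 ->
  abs (x - y) <= t -> abs p%:R <= t -> t <= 1 ->
  abs (x ^+ (p ^ n) - y ^+ (p ^ n)) <= t ^+ n.+1.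
Proof.
move=> x1 y1 xy pt t1; have t0 : 0 <= t by apply: le_trans xy; apply: abs_ge0.
elim: n => [|n IH]; first by rewrite !expr1.
rewrite expnSr !exprM; apply: le_trans (_ : t ^+ n.+1 * t <= _); last by rewrite -exprSr.
apply: le_trans (_ : abs (x ^+ (p ^ n) - y ^+ (p ^ n)) * t <= _).
  apply: abs_subXp_le; rewrite // ?absX ?exprn_ile1 ?abs_ge0 //.
  by apply: le_trans IH _; rewrite exprS ler_piMr // exprn_ile1.
by rewrite ler_wpM2r.
Qed.

(** * Residue classes of elements of Q_p and of algebraic numbers *)

Lemma int_residue (n : int) : exists e : 'I_p, abs (n%:~R - e%:R) < 1.
Proof.
have p0 : (p : int) != 0 by rewrite eqz_nat -lt0n prime_gt0.
have h : (`|(n %% p)%Z| < p)%N.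
  by rewrite -ltz_nat gez0_abs ?modz_ge0 // ltz_pmod // ltz_nat prime_gt0.
exists (Ordinal h) => /=; apply: le_lt_trans absp_lt1.
rewrite {1}(divz_eq n p) intrD intrM -addrA -[`|_|%N%:R]/(`|_|%N%:Z%:~R) gez0_abs ?modz_ge0 //.
by rewrite subrr addr0 absM ler_piMl ?abs_ge0 ?abs_int_le1.
Qed.

(** The denominator is prime to p, for otherwise the numerator would be and |q| > 1. A Bezout
    inverse of the denominator modulo p then reduces the claim to integers. *)
Lemma rat_residue (q : rat) : abs (ratr q) <= 1 ->
  exists e : 'I_p, abs (ratr q - e%:R) < 1.
Proof.
move=> q1; pose d := `|denq q|%N.
have dE : (denq q)%:~R = d%:R :> K.
  by rewrite -[d%:R]/(d%:Z%:~R) /d absz_denq.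
have dp : coprime d p.
  rewrite coprime_sym prime_coprime //; apply/negP => pd.
  have np : coprime `|numq q| p.
    rewrite coprime_sym (coprime_dvdl pd) // coprime_sym.
    exact: coprime_num_den.
  have n1 : abs (numq q)%:~R = 1.
    rewrite -(abs_coprime np); case: (numq q) => n //=.
    by rewrite NegzE mulrNz absN.
  have d0 : 0 < abs d%:R by rewrite abs_gt0 natr_neq0 // absz_gt0 denq_neq0.
  move: q1; rewrite /ratr abs_div n1 dE ler_pdivrMr // mul1r leNgt.
  by rewrite (le_lt_trans (abs_dvd_le pd) absp_lt1).
have d1 : abs d%:R = 1 := abs_coprime dp.
have d0 : d%:R != 0 :> K by rewrite -abs_eq0 d1 oner_neq0.
have d_gt0 : (0 < d)%N by rewrite absz_gt0 denq_neq0.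
have [km kn kE _] := egcdnP p d_gt0.
have [e he] := int_residue (numq q * km%:Z); exists e.
apply: abs_trans_lt he; rewrite /ratr dE intrM.
have -> : (numq q)%:~R / d%:R - (numq q)%:~R * km%:~R =
    (numq q)%:~R * (1 - (km * d)%:R) / d%:R :> K.
  by rewrite natrM mulrBr mulrBl mulr1 -!mulrA divff // mulr1.
rewrite kE (eqnP dp) natrD opprD addrCA subrr addr0 natrM !absM absN absV d1 invr1 mulr1.
apply: le_lt_trans absp_lt1; rewrite absM mulrA ler_piMl ?abs_ge0 //.
by rewrite mulr_ile1 ?abs_ge0 ?abs_int_le1 ?abs_nat_le1.
Qed.

(** [ratr] divides numerator by denominator inside K, so this rests on denominators not vanishing
    there. *)
Lemma ratrM (x y : rat) : ratr (x * y) = ratr x * ratr y :> K.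
Proof.
have nz (q : rat) : (denq q)%:~R != 0 :> K.
  case: (denq q) (denq_gt0 q) => // n n0; exact: natr_neq0.
have e : numq (x * y) * (denq x * denq y) = numq x * numq y * denq (x * y).
  apply: (@intr_inj rat); rewrite !intrM !numqE; ring.
have := congr1 (fun n : int => n%:~R : K) e; rewrite !intrM /ratr => {}e.
apply: (mulIf (nz (x * y))); rewrite divfK //; apply: (mulIf (mulf_neq0 (nz x) (nz y))).
by rewrite e; field; rewrite !nz.
Qed.

Lemma in_QpN x : in_Qp abs x -> in_Qp abs (- x).
Proof.
move=> hx e e0; have [q hq] := hx e e0; exists (- q).
by rewrite /ratr numqN denqN mulrNz mulNr -opprD absN.
Qed.

(** Q_p is given only as a closure of Q. Rational approximations of x and y with error less than |y|
    have a quotient congruent to x / y, and [rat_residue] applies to it. *)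
Lemma in_Qp_div_residue x y : in_Qp abs x -> in_Qp abs y -> y != 0 ->
  abs x <= abs y -> exists e : 'I_p, abs (x / y - e%:R) < 1.
Proof.
move=> hx hy; rewrite -abs_gt0 => y0 xy.
have [s hs] := hx _ y0; have [t ht] := hy _ y0.
have ty : abs (ratr t) = abs y by apply: abs_isosceles; rewrite absC.
have sy : abs (ratr s) <= abs y by rewrite -[ratr s](subKr x) absB_le ?(ltW hs).
have nz (z : K) : abs z = abs y -> z != 0 by rewrite -abs_gt0 => ->.
have t0 := nz _ ty; have y1 := nz _ erefl.
have stE : ratr s / ratr t = ratr (s / t) :> K.
  have t_neq0 : t != 0.
    by apply: contraNneq t0 => ->; rewrite (ratr_nat K 0).
  by apply: (mulIf t0); rewrite -ratrM divfK // divfK.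
have [|e he] := @rat_residue (s / t).
  by rewrite -stE abs_div ty ler_pdivrMr // mul1r.
exists e; apply: abs_trans_lt he; rewrite -stE.
have -> : x / y - ratr s / ratr t =
    ((x - ratr s) * ratr t - ratr s * (y - ratr t)) / (y * ratr t).
  by field; rewrite t0.
rewrite abs_div absM ty ltr_pdivrMr ?mulr_gt0 // mul1r.
apply: absB_lt; rewrite absM ?ty; first by rewrite ltr_pM2r.
by apply: le_lt_trans (_ : abs y * abs (y - ratr t) < _); rewrite ?ler_wpM2r ?abs_ge0 ?ltr_pM2l.
Qed.

(** The residue of v is a root of a monic polynomial over F_p. The equation of v is divided by its
    last coefficient of maximal absolute value: higher terms become small, lower ones are integral
    in Q_p and congruent to digits. *)
Lemma in_Qpbar_monic_relation v : in_Qpbar abs v -> abs v = 1 ->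
  exists d (e : 'I_d -> 'I_p), abs (v ^+ d - \sum_(k < d) (e k)%:R * v ^+ k) < 1.
Proof.
move=> [P [P0 PQ rP]] v1.
have sP : (0 < size P)%N by rewrite lt0n size_poly_eq0.
pose top (d : nat) := [forall j : 'I_(size P), abs P`_j <= abs P`_d].
have ex_top : exists d, (d < size P)%N && top d.
  pose d := [arg max_(i > Ordinal sP) abs P`_i]%O.
  exists d; rewrite ltn_ord; apply/forallP => j.
  by rewrite /d; case: arg_maxP => // i _; apply.
have [d /andP[dP /forallP dtop] dmax] := ex_maxnP ex_top (fun i h => ltnW (proj1 (andP h))).
have Pd0 : P`_d != 0.
  apply: contra P0 => /eqP Pd; rewrite -lead_coef_eq0.
  have lP : ((size P).-1 < size P)%N by rewrite prednK.
  by have := dtop (Ordinal lP);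
    rewrite Pd abs0 /= -/(lead_coef P) le_eqVlt ltNge abs_ge0 orbF abs_eq0.
have small j : (d < j)%N -> abs (P`_j / P`_d) < 1.
  move=> dj; rewrite abs_div ltr_pdivrMr ?abs_gt0 // mul1r.
  have [jP|jP] := ltnP j (size P); last by rewrite nth_default // abs0 abs_gt0.
  rewrite ltNge; apply/negP => dj'.
  have : (j <= d)%N.
    by apply: dmax; rewrite jP; apply/forallP => i; apply: le_trans (dtop i) _.
  by rewrite leqNgt dj.
have /choice [e he] (k : 'I_d) : exists e : 'I_p, abs ((- P`_k) / P`_d - e%:R) < 1.
  apply: in_Qp_div_residue => //; first exact: in_QpN.
  by rewrite absN; apply: (dtop (Ordinal (ltn_trans (ltn_ord k) dP))).
exists d, e.
have Pv : \sum_(i < size P) P`_i / P`_d * v ^+ i = 0.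
  transitivity (P.[v] / P`_d); last by rewrite (eqP rP) mul0r.
  by rewrite horner_coef mulr_suml; apply: eq_bigr => i _; rewrite mulrAC.
rewrite -(big_mkord xpredT (fun i => P`_i / P`_d * v ^+ i)) in Pv.
rewrite (big_cat_nat (n := d)) //= in Pv; last exact: ltnW.
rewrite [X in _ + X]big_ltn // divff // mul1r big_mkord in Pv.
have -> : v ^+ d - \sum_(k < d) (e k)%:R * v ^+ k =
    \sum_(k < d) ((- P`_k) / P`_d - (e k)%:R) * v ^+ k
    - \sum_(d.+1 <= i < size P) P`_i / P`_d * v ^+ i.
  have -> : \sum_(k < d) ((- P`_k) / P`_d - (e k)%:R) * v ^+ k =
      - \sum_(k < d) P`_k / P`_d * v ^+ k - \sum_(k < d) (e k)%:R * v ^+ k.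
    by rewrite -sumrN -sumrB; apply: eq_bigr => k _; rewrite mulrBl !mulNr.
  move/eqP: Pv; rewrite addrCA addr_eq0 => /eqP ->.
  by rewrite opprD addrAC.
apply: absB_lt.
  by apply: abs_sum_lt => // k _; rewrite absM absX v1 expr1n mulr1.
rewrite big_nat_cond; apply: abs_sum_lt => // k /andP[/andP[dk _] _].
by rewrite absM absX v1 expr1n mulr1 small.
Qed.

(** Modulo the maximal ideal all powers of v lie in the finite set of F_p-combinations of finitely
    many of them. Two powers are therefore congruent, and their quotient is a power congruent to
    1. *)
Lemma in_Qpbar_power_cycle v : in_Qpbar abs v -> abs v = 1 ->
  exists2 n, (0 < n)%N & abs (v ^+ n - 1) < 1.
Proof.
move=> hv v1; have [d [e he]] := in_Qpbar_monic_relation hv v1.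
case: d e he => [|d] e he.
  by move: he; rewrite big_ord0 subr0 expr0 abs1 ltxx.
have span i : exists c : 'I_d.+1 -> 'I_p, abs (v ^+ i - \sum_(k < d.+1) (c k)%:R * v ^+ k) < 1.
  suff [c hc] : exists c : nat -> int, abs (v ^+ i - \sum_(k < d.+1) (c k)%:~R * v ^+ k) < 1.
    have /choice [c' hc'] (k : 'I_d.+1) := int_residue (c k).
    exists c'; apply: abs_trans_lt hc _; rewrite -sumrB; apply: abs_sum_lt => // k _.
    by rewrite -mulrBl absM absX v1 expr1n mulr1.
  elim: i => [|i [c hc]].
    exists (fun k => (k == 0%N)%:R); rewrite big_ord_recl /= mul1r big1 ?addr0 ?subrr ?abs0 //.
    by move=> k _; rewrite mul0r.
  (* Multiplication by v shifts the coefficients, and the term c_d v^(d+1) is rewritten by the monic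
     relation. The new integers are reduced to digits only afterwards; [insub] merely turns k into
     an index of [e]. *)
  exists (fun k => (if k is k'.+1 then c k' else 0) +
    c d * (if insub k is Some k0 then e k0 : nat else 0%N)%:Z).
  have vc : abs (v ^+ i.+1 - \sum_(k < d.+1) (c k)%:~R * v ^+ k.+1) < 1.
    rewrite exprS -[X in _ - X](_ : v * \sum_(k < d.+1) (c k)%:~R * v ^+ k = _).
      by rewrite -mulrBr absM v1 mul1r.
    by rewrite mulr_sumr; apply: eq_bigr => k _; rewrite exprS mulrCA.
  apply: abs_trans_lt vc _; rewrite big_ord_recr /=.
  under [X in _ - X]eq_bigr => k _ do rewrite valK intrD intrM mulrDl -mulrA.
  rewrite big_split /= -mulr_sumr big_ord_recl /= mul0r add0r.
  rewrite [X in _ - (X + _)](_ : _ = \sum_(k < d) (c k)%:~R * v ^+ k.+1) //.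
  rewrite opprD addrACA subrr add0r -mulrBr absM; apply: le_lt_trans he.
  by rewrite ler_piMl ?abs_ge0 ?abs_int_le1.
have /choice [c hc] := span.
pose g (i : 'I_(#|{ffun 'I_d.+1 -> 'I_p}|.+1)) := [ffun k => c i k].
have /injectivePn [i [j ij gij]] : ~~ injectiveb g.
  by apply/injectiveP => /leq_card; rewrite card_ord ltnn.
wlog lt_ij : i j ij gij / (i < j)%N.
  move=> H; have := ij; rewrite -(inj_eq val_inj) /= neq_ltn => /orP[|] h; first exact: (H i j).
  by apply: (H j i) => //; rewrite eq_sym.
exists (j - i)%N; first by rewrite subn_gt0.
have : abs (v ^+ j - v ^+ i) < 1.
  apply: abs_trans_lt (hc j) _; rewrite absC.
  suff -> : \sum_(k < d.+1) (c j k)%:R * v ^+ k = \sum_(k < d.+1) (c i k)%:R * v ^+ k by [].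
  by apply: eq_bigr => k _; move/ffunP/(_ k): gij; rewrite !ffunE => ->.
by rewrite -{1}(subnK (ltnW lt_ij)) exprD -{2}[v ^+ i]mul1r -mulrBl absM absX v1 expr1n mulr1.
Qed.

(** A nearby algebraic number gives u^n congruent to 1. Injectivity of Frobenius removes the p-part
    of n, leaving m prime to p, and u^m - 1 is the product of the u - z over the m-th roots of unity
    z. *)
Lemma ex_unity_near u : abs u = 1 ->
  exists z, (exists n, [/\ (0 < n)%N, coprime n p & n.-primitive_root z]) /\ abs (u - z) < 1.
Proof.
move=> u1; have [v vQ uv] := Cp_Qpbar_dense K_Cp u (@ltr01 RR).
have v1 : abs v = 1 by rewrite -u1; apply: abs_isosceles; rewrite absC u1.
have [n n0 vn] := in_Qpbar_power_cycle vQ v1.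
pose m := (n`_p^')%N; have m0 : (0 < m)%N by rewrite part_gt0.
have mp : coprime m p by rewrite coprime_sym (pnat_coprime (pnat_id p_prime)) ?part_pnat.
have um : abs (u ^+ m - 1) < 1.
  apply: (@abs_subXpn_lt1 _ _ (logn p n)); rewrite ?absX ?abs1 ?u1 ?expr1n //.
  rewrite -exprM -p_part mulnC partnC //; apply: abs_trans_lt vn.
  by apply: le_lt_trans uv; rewrite abs_expr_sub_le ?u1 ?v1.
have [rs srs rsE] := unity_prod m0.
have [||z zrs uz] := @near_root rs 1 u; rewrite ?ler01 //.
  by rewrite -rsE !hornerE expr1n.
have zm : z ^+ m = 1.
  have : root ('X^m - 1) z by rewrite rsE root_prod_XsubC.
  by rewrite /root !hornerE subr_eq0 => /eqP.
have [k zk km] := prim_order_exists m0 zm.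
exists z; split=> //; exists k; split=> //; first exact: prim_order_gt0 zk.
exact: coprime_dvdl mp.
Qed.

(** For w of order n prime to p, Euler's theorem gives p^totient(n) congruent to 1 modulo n, whence
    the period. For |u| < 1 the value is 0, which every power fixes. *)
Lemma teichmullerP u : abs u <= 1 -> let w := teichmuller p abs u in
  [/\ abs (u - w) < 1, abs w <= 1 &
      exists2 l, (0 < l)%N & forall k, (l %| k)%N -> w ^+ (p ^ k) = w].
Proof.
rewrite le_eqVlt /teichmuller => /orP[/eqP u1|u1] /=; last first.
  rewrite ifN ?lt_eqF // subr0 abs0 ler01; split=> //; exists 1%N => // k _.
  by rewrite expr0n expn_eq0 eqn0Ngt prime_gt0.
rewrite u1 eqxx; have [[n [n0 np zn]] uz] := xgetPex 0 (ex_unity_near u1).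
split=> //; first by rewrite (abs_prim_root zn).
exists (totient n); first by rewrite totient_gt0.
move=> _ /dvdnP[k ->]; rewrite mulnC expnM -(prim_expr_mod zn).
rewrite -modnXm Euler_exp_totient; last by rewrite coprime_sym.
by rewrite modnXm exp1n (prim_expr_mod zn) expr1.
Qed.

(** * Approximation by simple fractions *)

(** Inductive rather than an explicit partial fraction sum, so that residues and limits of means are
    obtained by induction on the four cases. *)
Inductive simple_fraction (D : set K) : (K -> K) -> Prop :=
| simple_poly P : simple_fraction D (horner P)
| simple_pole c : ~ D c -> simple_fraction D (fun x => (x - c)^-1)
| simple_add f g : simple_fraction D f -> simple_fraction D g ->
    simple_fraction D (fun x => f x + g x)
| simple_scale c f : simple_fraction D f -> simple_fraction D (fun x => c * f x).

Definition simple_approx (D : set K) (f : K -> K) : Prop :=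
  forall e : RR, 0 < e -> exists2 g, simple_fraction D g &
    forall x, D x -> abs (f x - g x) < e.

Lemma simple_approx_eq D f g : (forall x, D x -> f x = g x) ->
  simple_approx D g -> simple_approx D f.
Proof. by move=> fg hg e /hg[h sh gh]; exists h => // x Dx; rewrite fg ?gh. Qed.

Lemma simple_approx_refl D f : simple_fraction D f -> simple_approx D f.
Proof. by move=> sf e e0; exists f => // x _; rewrite subrr abs0. Qed.

Lemma simple_approx_add D f g : simple_approx D f -> simple_approx D g ->
  simple_approx D (fun x => f x + g x).
Proof.
move=> hf hg e e0; have [f' sf ff] := hf e e0; have [g' sg gg] := hg e e0.
exists (fun x => f' x + g' x); first exact: simple_add.
by move=> x Dx; rewrite opprD addrACA absD_lt ?ff ?gg.
Qed.

Lemma simple_approx_scale D c f : simple_approx D f ->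
  simple_approx D (fun x => c * f x).
Proof.
have [->|c0] := eqVneq c 0 => hf e e0.
  exists (horner 0); first exact: simple_poly.
  by move=> x _; rewrite mul0r horner0 subrr abs0.
have [f' sf ff] := hf (e / abs c) (divr_gt0 e0 (etrans (abs_gt0 c) c0)).
exists (fun x => c * f' x); first exact: simple_scale.
by move=> x Dx; rewrite -mulrBr absM mulrC -ltr_pdivlMr ?abs_gt0 // ff.
Qed.

Lemma simple_approx_lim D f : (forall e : RR, 0 < e -> exists2 g,
    simple_approx D g & forall x, D x -> abs (f x - g x) < e) -> simple_approx D f.
Proof.
move=> hf e e0; have [g hg fg] := hf e e0; have [h sh gh] := hg e e0.
by exists h => // x Dx; apply: abs_trans_lt (fg x Dx) (gh x Dx).
Qed.

(** Closedness of D in the form in which it serves: 1 / (x - c) is bounded on D for each c outside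
    D. *)
Definition abs_closed (D : set K) : Prop :=
  forall c, ~ D c -> exists2 r : RR, 0 < r & forall x, D x -> r <= abs (x - c).

(* A double pole is the limit of pairs of simple poles, so that simple fractions
   suffice for uniform approximation. *)
Lemma simple_approx_double_pole D c : abs_closed D -> ~ D c ->
  simple_approx D (fun x => (x - c)^-1 * (x - c)^-1).
Proof.
move=> cD nDc e e0; have [r r0 hr] := cD c nDc.
(* |z| < r keeps c + z outside D and as far from its points as c. The error is z / ((x - c)^2 (x - c
   - z)) up to sign, at most |z| / r^3, hence the second bound. *)
have [|z z0] := @exists_abs_lt (Num.min r (e * r ^+ 3)).
  by rewrite lt_min r0 mulr_gt0 ?exprn_gt0.
rewrite lt_min => /andP[zr ze].
have xcz x : D x -> abs (x - (c + z)) = abs (x - c).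
  move=> Dx; apply: abs_isosceles; rewrite (_ : _ - (x - c) = - z); last by ring.
  by rewrite absN (lt_le_trans zr) ?hr.
have nDcz : ~ D (c + z).
  move=> Dcz; have := xcz _ Dcz; rewrite subrr abs0 => /esym h.
  by have := hr _ Dcz; rewrite h leNgt r0.
exists (fun x => z^-1 * ((x - (c + z))^-1 + (-1) * (x - c)^-1)).
  by apply/simple_scale/simple_add; [|apply: simple_scale]; apply: simple_pole.
move=> x Dx; have rx := hr x Dx; have x0 : 0 < abs (x - c) by apply: lt_le_trans rx.
have xc0 : x - c != 0 by rewrite -abs_gt0.
have xz0 : x - (c + z) != 0 by rewrite -abs_gt0 xcz.
rewrite [X in abs X](_ : _ = - z / ((x - c) ^+ 2 * (x - (c + z)))); last first.
  by field; rewrite z0 xz0 xc0.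
rewrite abs_div absN absM absX xcz // -exprSr ltr_pdivrMr ?exprn_gt0 //.
apply: lt_le_trans ze _; rewrite ler_pM2l // lerXn2r ?nnegrE ?abs_ge0 //.
exact: ltW.
Qed.

(** Multiplication by the bounded function 1 / (x - c) respects uniform limits, so f may be a simple
    fraction. Polynomials are divided with remainder, and distinct poles are separated by partial
    fractions; a coinciding one gives the double pole. *)
Lemma simple_approx_pole D c f : abs_closed D -> ~ D c -> simple_approx D f ->
  simple_approx D (fun x => f x * (x - c)^-1).
Proof.
move=> cD nDc hf; have xc0 x : D x -> x - c != 0.
  by move=> Dx; rewrite subr_eq0; apply: contra_not_neq nDc => <-.
apply: simple_approx_lim => e e0; have [r r0 hr] := cD c nDc.
have [g sg fg] := hf (e * r) (mulr_gt0 e0 r0).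
exists (fun x => g x * (x - c)^-1); last first.
  move=> x Dx; rewrite -mulrBl abs_div ltr_pdivrMr ?abs_gt0 ?xc0 //.
  by apply: lt_le_trans (fg x Dx) _; rewrite ler_pM2l // hr.
elim: sg => {e e0 fg g} [P|b nDb|g h _ IHg _ IHh|b g _ IHg].
- have [q Pq] : exists q, P - P.[c]%:P = q * ('X - c%:P).
    by apply/factor_theorem; rewrite /root !hornerE subrr.
  apply: (@simple_approx_eq _ _ (fun x => q.[x] + P.[c] * (x - c)^-1)).
    move=> x Dx; have := congr1 (fun r => r.[x]) Pq; rewrite !hornerE => /eqP.
    by rewrite subr_eq => /eqP ->; rewrite mulrDl mulfK ?xc0.
  apply/simple_approx_refl/simple_add; first exact: simple_poly.
  exact/simple_scale/simple_pole.
- have [->|bc] := eqVneq b c; first exact: simple_approx_double_pole.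
  have xb0 x : D x -> x - b != 0.
    by move=> Dx; rewrite subr_eq0; apply: contra_not_neq nDb => <-.
  apply: (@simple_approx_eq _ _ (fun x => (b - c)^-1 * ((x - b)^-1 + (-1) * (x - c)^-1))).
    by move=> x Dx; field; rewrite xc0 ?xb0 // subr_eq0 bc.
  apply/simple_approx_refl/simple_scale/simple_add; first exact: simple_pole.
  exact/simple_scale/simple_pole.
- by apply: simple_approx_eq (simple_approx_add IHg IHh) => x _; rewrite mulrDl.
- by apply: simple_approx_eq (simple_approx_scale b IHg) => x _; rewrite mulrA.
Qed.

Lemma krasner_simple_approx D f : abs_closed D -> krasner_analytic abs D f ->
  simple_approx D f.
Proof.
move=> cD [P [Q [Q0 fPQ]]]; apply: simple_approx_lim => e /fPQ[n /(_ n (leqnn n)) hn].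
exists (fun x => (P n).[x] / (Q n).[x]) => // {hn}.
(* A zero denominator is possible only for empty D, where any approximant will do. *)
have [Qn0|Qn0] := eqVneq (Q n) 0.
  apply: (@simple_approx_eq _ _ (horner 0)).
    by move=> x /(Q0 n); rewrite Qn0 horner0 eqxx.
  exact/simple_approx_refl/simple_poly.
have [rs rsE] := poly_split Qn0.
have : forall z, z \in rs -> ~ D z.
  move=> z zrs /(Q0 n); rewrite rsE hornerZ mulf_eq0 negb_or => /andP[_].
  by rewrite -/(root _ z) root_prod_XsubC zrs.
have -> : (fun x => (P n).[x] / (Q n).[x]) = (fun x =>
    (lead_coef (Q n))^-1 * ((P n).[x] * \prod_(z <- rs) (x - z)^-1)).
  apply/funext => x; rewrite {1}rsE hornerZ horner_prod invfM mulrCA; congr (_ * (_ * _)).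
  by rewrite -prodfV; apply: eq_bigr => z _; rewrite !hornerE.
move=> nD; apply: simple_approx_scale; elim: rs {rsE} nD => [|z rs IH] nD.
  apply: (@simple_approx_eq _ _ (horner (P n))); first by move=> x _; rewrite big_nil mulr1.
  exact/simple_approx_refl/simple_poly.
apply: (@simple_approx_eq _ _
  (fun x => ((P n).[x] * \prod_(z <- rs) (x - z)^-1) * (x - z)^-1)).
  by move=> x _; rewrite big_cons mulrA mulrAC.
apply: simple_approx_pole => //; first exact: nD (mem_head _ _).
by apply: IH => y yrs; apply: nD; rewrite inE yrs orbT.
Qed.

(** * Means over roots of unity along an arc *)

(** The number n of roots of unity replaces the exponent of p: the explicit formulas for polynomials
    and simple poles hold for general n. *)
Definition arc_mean (a b : K) (f : K -> K) (n : nat) : K :=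
  n%:R^-1 * \sum_(z \in [set z : K | z ^+ n = 1])
     (let x := a + (b - a) * z in (x - a) * f x).

Lemma path_averageE a b f phi k :
  path_average p a b f phi k = arc_mean a b f (p ^ phi k).
Proof. by rewrite /path_average /arc_mean natrX. Qed.

Lemma arc_meanE a b f n w : n.-primitive_root w ->
  arc_mean a b f n =
  (b - a) * (n%:R^-1 * \sum_(i < n) w ^+ i * f (a + (b - a) * w ^+ i)).
Proof.
move=> wn; rewrite /arc_mean.
have -> : [set z : K | z ^+ n = 1] = [set` [seq w ^+ i | i <- iota 0 n]].
  apply/seteqP; split=> z /=.
    by case/(prim_rootP wn)=> i ->; apply/mapP; exists (i : nat); rewrite // mem_iota /=.
  by case/mapP=> i _ ->; rewrite exprAC (prim_expr_order wn) expr1n.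
rewrite -fsbig_seq /=; last first.
  rewrite map_inj_in_uniq ?iota_uniq // => i j; rewrite !mem_iota /= => ni nj /eqP.
  by rewrite (eq_prim_root_expr wn) !modn_small // => /eqP.
have -> : iota 0 n = index_iota 0 n by rewrite /index_iota subn0.
rewrite big_map big_mkord [RHS]mulrCA; congr (_ * _).
rewrite mulr_sumr; apply: eq_bigr => i _.
by rewrite addrAC subrr add0r mulrA.
Qed.

Lemma arc_mean_add a b f g n : (0 < n)%N ->
  arc_mean a b (fun x => f x + g x) n = arc_mean a b f n + arc_mean a b g n.
Proof.
move=> n0; have [w wn] := ex_prim_root n0; rewrite !(arc_meanE _ _ _ wn) -!mulrDr.
by rewrite -big_split; do 2 congr (_ * _); apply: eq_bigr => i _; rewrite mulrDr.
Qed.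

Lemma arc_mean_scale a b c f n : (0 < n)%N ->
  arc_mean a b (fun x => c * f x) n = c * arc_mean a b f n.
Proof.
move=> n0; have [w wn] := ex_prim_root n0; rewrite !(arc_meanE _ _ _ wn).
rewrite [RHS]mulrCA; congr (_ * _); rewrite [RHS]mulrCA; congr (_ * _).
by rewrite mulr_sumr; apply: eq_bigr => i _; rewrite mulrCA.
Qed.

Lemma arc_mean_sub a b f g n : (0 < n)%N ->
  arc_mean a b (fun x => f x - g x) n = arc_mean a b f n - arc_mean a b g n.
Proof.
move=> n0; rewrite -[X in _ - X]mul1r -mulNr -arc_mean_scale // -arc_mean_add //.
by congr (arc_mean _ _ _ _); apply/funext => x; rewrite mulN1r.
Qed.

Lemma mean_prim_root_poly (T : {poly K}) n w : n.-primitive_root w ->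
  n%:R^-1 * (\sum_(i < n) w ^+ i * T.[w ^+ i]) =
  \sum_(m < size T | (n %| m.+1)%N) T`_m.
Proof.
move=> wn; have n0 := prim_order_gt0 wn.
under eq_bigr do rewrite horner_coef mulr_sumr.
rewrite exchange_big mulr_sumr [RHS]big_mkcond; apply: eq_bigr => m _ /=.
under eq_bigr do rewrite mulrCA -exprS.
rewrite -mulr_sumr (sum_prim_root _ wn); case: ifP => _; last by rewrite !mulr0.
by rewrite mulrCA mulVf ?mulr1 ?natr_neq0.
Qed.

Lemma arc_mean_poly a b (P : {poly K}) n : (size P < n)%N ->
  arc_mean a b (horner P) n = 0.
Proof.
move=> Pn; have [|w wn] := @ex_prim_root n; first exact: leq_ltn_trans Pn.
rewrite (arc_meanE _ _ _ wn).
pose L : {poly K} := a%:P + (b - a) *: 'X.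
have hT i : P.[a + (b - a) * w ^+ i] = (P \Po L).[w ^+ i].
  by rewrite horner_comp !hornerE.
under eq_bigr do rewrite hT.
rewrite (mean_prim_root_poly _ wn) big1 ?mulr0 // => m /(dvdn_leq (ltn0Sn m)) nm.
have s2 : (size L <= 2)%N.
  rewrite (leq_trans (size_polyD _ _)) // geq_max (leq_trans (size_polyC_leq1 _)) //.
  by rewrite (leq_trans (size_scale_leq _ _)) ?size_polyX.
have := size_comp_poly_leq P L; have := ltn_ord m.
have P0 : (0 < size P)%N.
  rewrite lt0n size_poly_eq0; apply: contraTneq (leq_ltn_trans (leq0n m) (ltn_ord m)) => ->.
  by rewrite comp_poly0 size_poly0.
by move: P0 s2 nm Pn; move: (size L) (size P) (size _) (nat_of_ord m) => s t q k; clear; nia.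
Qed.

(** For zeta^n = 1, zeta - u divides 1 - u^n = zeta^n - u^n, so zeta / (zeta - u) is a combination
    of the u^j zeta^(n-j) with 0 <= j < n. Only j = 0 survives the averaging. *)
Lemma arc_mean_pole a b c n : (0 < n)%N -> a != b ->
  ((c - a) / (b - a)) ^+ n != 1 ->
  arc_mean a b (fun x => (x - c)^-1) n = (1 - ((c - a) / (b - a)) ^+ n)^-1.
Proof.
move=> n0 ab; set u := _ / _ => un1; have [w wn] := ex_prim_root n0.
have ba0 : b - a != 0 by rewrite subr_eq0 eq_sym.
have un0 : 1 - u ^+ n != 0 by rewrite subr_eq0 eq_sym.
have wi0 i : w ^+ i != 0.
  by rewrite expf_neq0 // (prim_root_eq0 wn) -lt0n.
have key (i : 'I_n) : w ^+ i * (a + (b - a) * w ^+ i - c)^-1 =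
    ((b - a) * (1 - u ^+ n))^-1 * \sum_(j < n) u ^+ j * (w ^+ i) ^+ (n - j).
  have -> : a + (b - a) * w ^+ i - c = (b - a) * (w ^+ i - u).
    by rewrite mulrBr /u [_ * (_ / _)]mulrC divfK //; ring.
  have win : (w ^+ i) ^+ n = 1 by rewrite exprAC (prim_expr_order wn) expr1n.
  have wu0 : w ^+ i - u != 0.
    by rewrite subr_eq0; apply: contraNneq un1 => <-; rewrite win.
  have -> : \sum_(j < n) u ^+ j * (w ^+ i) ^+ (n - j) =
      w ^+ i * (1 - u ^+ n) / (w ^+ i - u).
    apply: (mulIf wu0); rewrite divfK // -win subrXX [RHS]mulrCA [LHS]mulrC.
    congr (_ * _).
    rewrite mulr_sumr; apply: eq_bigr => j _; rewrite mulrA -exprS mulrC.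
    by congr (_ ^+ _ * _); have := ltn_ord j; move: (nat_of_ord j); clear; lia.
  by field; rewrite wu0 ba0 un0.
rewrite (arc_meanE _ _ _ wn); under eq_bigr do rewrite key.
rewrite -mulr_sumr; set S := (X in _ * (_ * (_ * X))).
suff -> : S = n%:R by field; rewrite un0 ba0 natr_neq0.
rewrite /S exchange_big /= (bigD1 (Ordinal n0)) //= [X in _ + X]big1 ?addr0.
  under eq_bigr do rewrite expr0 mul1r subn0.
  by rewrite (sum_prim_root _ wn) dvdnn.
move=> j j0; rewrite -mulr_sumr (sum_prim_root _ wn) ifN ?mulr0 //.
have jn := ltn_ord j; apply/negP => /dvdn_leq; rewrite subn_gt0 jn => /(_ isT).
have : (0 < j)%N by rewrite lt0n; apply: contraNneq j0 => j0; apply/eqP/val_inj.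
lia.
Qed.

(** This places the sample points a + (b - a) z inside the arc around b. *)
Lemma root_p_expn_near1 m z : z ^+ (p ^ m) = 1 -> abs (z - 1) < 1.
Proof.
move=> zm; have z1 : abs z = 1.
  by apply: (@abs_expr_eq1 _ (p ^ m)); rewrite ?expn_gt0 ?prime_gt0 ?zm ?abs1.
by apply: (@abs_subXpn_lt1 _ _ m); rewrite ?abs1 ?z1 // zm expr1n subrr abs0.
Qed.

(** The factor 1 / |p^m| is harmless for an error term that can be chosen after m. *)
Lemma arc_mean_le_crude a b f m (e : RR) : 0 <= e ->
  (forall z, abs (z - 1) < 1 -> abs (f (a + (b - a) * z)) <= e) ->
  abs (arc_mean a b f (p ^ m)) <= abs (b - a) * (e / abs (p ^ m)%:R).
Proof.
move=> e0 hf; have pm0 : (0 < p ^ m)%N by rewrite expn_gt0 prime_gt0.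
have [w wn] := ex_prim_root pm0; rewrite (arc_meanE _ _ _ wn) absM ler_wpM2l ?abs_ge0 //.
rewrite absM absV mulrC ler_wpM2r ?invr_ge0 ?abs_ge0 //.
apply: abs_sum_le => // i _; rewrite absM absX (abs_prim_root wn) expr1n mul1r hf //.
by apply: (@root_p_expn_near1 m); rewrite exprAC (prim_expr_order wn) expr1n.
Qed.

Lemma horner_sub_le (P : {poly K}) x y : (forall i, abs P`_i <= 1) ->
  abs x <= 1 -> abs y <= 1 -> abs (P.[x] - P.[y]) <= abs (x - y).
Proof.
move=> hP x1 y1; rewrite !horner_coef -sumrB; apply: abs_sum_le => [|i _].
  exact: abs_ge0.
rewrite -mulrBr absM -[leRHS]mul1r ler_pM ?abs_ge0 //.
exact: abs_expr_sub_le.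
Qed.

(* Away from the zeros of [Q], normalized by [Q(1) = 1], the quotient [P / Q] is
   the limit of the polynomials [P * (1 + S + ... + S^(k-1))] with [S = 1 - Q].
   These have coefficients bounded by [e], and the mean of a polynomial over the
   roots of unity is a sum of coefficients: no denominator [n] appears. *)
Lemma mean_fraction_le (P Q : {poly K}) m w (e : RR) : 0 < e ->
  (p ^ m).-primitive_root w ->
  (forall z, abs (z - 1) < 1 -> Q.[z] != 0) ->
  (forall z, abs (z - 1) < 1 -> abs (P.[z] / Q.[z]) <= e) ->
  abs ((p ^ m)%:R^-1 * \sum_(i < p ^ m) w ^+ i * (P.[w ^+ i] / Q.[w ^+ i])) <= e.
Proof.
move=> e0 wn Q0 hPQ; have c1 : abs (1 - 1) < 1 by rewrite subrr abs0.
wlog {Q0} Q1 : P Q hPQ / Q.[1] = 1 /\ forall i, abs Q`_i <= 1.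
  move=> H; have Qn0 : Q != 0 by apply: contraNneq (Q0 1 c1) => ->; rewrite horner0.
  pose c := Q.[1]^-1; have cn0 : c != 0 by rewrite invr_eq0 Q0.
  have PQE z : P.[z] / Q.[z] = (c *: P).[z] / (c *: Q).[z].
    by rewrite !hornerZ invfM mulrACA divff ?mul1r.
  under eq_bigr do rewrite PQE.
  apply: H => [z z1|]; first by rewrite -PQE hPQ.
  split; first by rewrite hornerZ /c mulVf ?Q0.
  have [rs rsE] := poly_split Qn0.
  have far z : z \in rs -> 1 <= abs (1 - z).
    move=> zrs; rewrite leNgt absC; apply/negP => /Q0.
    by rewrite rsE hornerZ mulf_eq0 negb_or -/(root _ z) root_prod_XsubC zrs andbF.
  (* The roots z lie outside the open disc around 1, so |1 - z| >= 1 and |z| <= |1 - z|: each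
     normalized factor has integral coefficients. *)
  have -> : c *: Q = \prod_(z <- rs) ((1 - z)^-1 *: ('X - z%:P)).
    have lQ0 : lead_coef Q != 0 by rewrite lead_coef_eq0.
    move: (lead_coef Q) rsE lQ0 => l rsE l0.
    rewrite /c rsE hornerZ horner_prod invfM scalerA mulrAC mulVf // mul1r.
    rewrite scaler_prod -prodfV; congr (_ *: _).
    by apply: eq_bigr => z _; rewrite !hornerE.
  elim: rs far {rsE} => [|z rs IH] far i.
    by rewrite big_nil coef1; case: eqP; rewrite ?abs1 ?abs0 ?ler01.
  rewrite big_cons -[leRHS]mulr1; apply: coefM_le => // {i} [i|].
    have z1 := far z (mem_head _ _); have z0 : 0 < abs (1 - z) by apply: lt_le_trans z1.
    rewrite coefZ absM absV mulrC ler_pdivrMr // mul1r coefB coefX coefC.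
    have hz : abs z <= abs (1 - z).
      by rewrite -[z in leLHS](subKr 1) absB_le ?abs1.
    by case: i => [|[|i]] /=; rewrite ?sub0r ?subr0 ?absN ?abs1 ?abs0 ?(ltW z0).
  by apply: IH => y yrs; apply: far; rewrite inE yrs orbT.
case: Q1 => Q1 Qi.
have near1 z : abs (z - 1) < 1 -> abs z = 1.
  by move=> z1; rewrite -abs1; apply: abs_isosceles; rewrite abs1.
have Sz z : abs (z - 1) < 1 -> abs (1 - Q.[z]) <= abs (z - 1).
  by move=> z1; rewrite -{1}Q1 absC horner_sub_le ?abs1 ?(near1 z).
have Qz z : abs (z - 1) < 1 -> abs Q.[z] = 1.
  move=> z1; rewrite -abs1; apply: abs_isosceles; rewrite abs1 absC.
  exact: le_lt_trans (Sz z z1) z1.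
have Pz z : abs (z - 1) < 1 -> abs P.[z] <= e.
  by move=> z1; have := hPQ z z1; rewrite abs_div Qz // divr1.
have Pi := coef_le_odisc Pz.
have n0 : 0 < abs (p ^ m)%:R by rewrite abs_gt0 natr_neq0 ?expn_gt0 ?prime_gt0.
have wi i : abs (w ^+ i - 1) < 1.
  by apply: (@root_p_expn_near1 m); rewrite exprAC (prim_expr_order wn) expr1n.
have /choice [N hN] (i : 'I_(p ^ m)) : exists N, forall k, (N <= k)%N ->
    abs (w ^+ i - 1) ^+ k < abs (p ^ m)%:R.
  by apply: expr_lt_eps => //; rewrite abs_ge0 wi.
(* The remainder P / Q (1 - Q)^k is below e |p^m| at all the roots of unity, which absorbs the
   denominator p^m. *)
pose k := (\max_i N i)%N; pose T := P * \sum_(j < k) (1 - Q) ^+ j.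
have Ti i : abs T`_i <= e.
  rewrite -[e]mulr1; apply: coefM_le => // [|{}i]; first exact: ltW.
  rewrite coef_sum; apply: abs_sum_le => // j _; apply: coefX_le1 => l.
  by rewrite coefB coef1 absB_le //; case: eqP; rewrite ?abs1 ?abs0 ?ler01.
have TE z : abs (z - 1) < 1 -> P.[z] / Q.[z] = T.[z] + P.[z] / Q.[z] * (1 - Q.[z]) ^+ k.
  move=> z1; have Qz0 : Q.[z] != 0 by rewrite -abs_gt0 Qz.
  rewrite hornerM horner_sum; under eq_bigr do rewrite horner_exp !hornerE.
  move/eqP: (subrX1 (1 - Q.[z]) k); rewrite subr_eq => /eqP ->.
  by move: (\sum_(i < k) _) => G; field.
under eq_bigr do rewrite TE // mulrDr.
rewrite big_split mulrDr; apply: absD_le.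
  by rewrite (mean_prim_root_poly _ wn) abs_sum_le ?(ltW e0).
rewrite absM absV mulrC ler_pdivrMr //; apply: abs_sum_le => [|i _].
  by rewrite mulr_ge0 ?abs_ge0 ?(ltW e0).
rewrite absM absX (abs_prim_root wn) expr1n mul1r absM ler_pM ?abs_ge0 ?hPQ //.
rewrite absX; apply: le_trans (ltW (hN i k _)); last exact: leq_bigmax.
by rewrite lerXn2r ?nnegrE ?abs_ge0 ?Sz.
Qed.

(** With m fixed, f is replaced by a rational function up to e |p^m|. The crude bound covers the
    difference, and the bound without denominator covers the rational function. *)
Lemma arc_mean_le (D : set K) a b f m (e : RR) : a != b -> 0 < e ->
  odisc abs b (abs (b - a)) `<=` D -> krasner_analytic abs D f ->
  (forall x, D x -> abs (f x) <= e) ->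
  abs (arc_mean a b f (p ^ m)) <= abs (b - a) * e.
Proof.
move=> ab e0 sD [P [Q [Q0 fPQ]]] fe.
have pm0 : (0 < p ^ m)%N by rewrite expn_gt0 prime_gt0.
have ba0 : 0 < abs (b - a) by rewrite abs_gt0 subr_eq0 eq_sym.
have n0 : 0 < abs (p ^ m)%:R by rewrite abs_gt0 natr_neq0.
have n1 : abs (p ^ m)%:R <= 1 := abs_nat_le1 _.
have inD z : abs (z - 1) < 1 -> D (a + (b - a) * z).
  move=> z1; apply: sD; rewrite /odisc /=.
  rewrite (_ : a + (b - a) * z - b = (b - a) * (z - 1)); last by ring.
  by rewrite absM gtr_pMr.
have [N hN] := fPQ (e * abs (p ^ m)%:R) (mulr_gt0 e0 n0).
have {hN fPQ} h := hN N (leqnn N); move: (P N) (Q N) (Q0 N) h => {Q0}{}P {}Q Q0 h.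
pose g x := P.[x] / Q.[x].
have -> : arc_mean a b f (p ^ m) =
    arc_mean a b (fun x => f x - g x) (p ^ m) + arc_mean a b g (p ^ m).
  by rewrite -arc_mean_add //; congr arc_mean; apply/funext => x; rewrite subrK.
apply: absD_le.
  apply: le_trans (@arc_mean_le_crude a b _ m (e * abs (p ^ m)%:R) _ _) _.
  - by rewrite mulr_ge0 ?ltW.
  - by move=> z /inD Dz; rewrite ltW ?h.
  - by rewrite mulfK ?gt_eqF.
have [w wn] := ex_prim_root pm0; rewrite (arc_meanE _ _ _ wn) absM ler_wpM2l ?abs_ge0 //.
pose L : {poly K} := a%:P + (b - a) *: 'X.
have LE (T : {poly K}) z : T.[a + (b - a) * z] = (T \Po L).[z].
  by rewrite horner_comp !hornerE.
rewrite /g; under eq_bigr do rewrite !LE.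
apply: mean_fraction_le => // z /inD Dz; rewrite -!LE; first exact: Q0.
rewrite -[_ / _](subKr (f (a + (b - a) * z))) absB_le ?fe // ltW //.
by apply: lt_le_trans (h _ Dz) _; rewrite ler_piMr ?(ltW e0).
Qed.

(** * Laurent expansions *)

Definition laurent_sum (c : int -> K) (w : K) (m n : nat) : K :=
  \sum_(0 <= k < n) c k%:Z * w ^+ k + \sum_(1 <= k < m) c (- k%:Z) * w ^- k.

Lemma laurent_sumB c d w m n :
  laurent_sum c w m n - laurent_sum d w m n = laurent_sum (fun k => c k - d k) w m n.
Proof.
rewrite /laurent_sum opprD addrACA -!sumrB.
by congr (_ + _); apply: eq_bigr => k _; rewrite mulrBl.
Qed.

Lemma laurent_sum_le c w m n (e : RR) : 0 <= e ->
  (forall k : int, abs (c k * w ^ k) <= e) -> abs (laurent_sum c w m n) <= e.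
Proof.
move=> e0 h; apply: absD_le; apply: abs_sum_le => // k _.
by have := h (- k%:Z); rewrite exprnN.
Qed.

(** The truncation to exponents from -N to N - 1, shifted so that multiplication by w^N visibly
    makes it a polynomial. *)
Lemma laurent_sum_symm c w N :
  laurent_sum c w N.+1 N = \sum_(j < N + N) c (j%:Z - N%:Z) * w ^ (j%:Z - N%:Z).
Proof.
rewrite -(big_mkord xpredT (fun j : nat => c (j%:Z - N%:Z) * w ^ (j%:Z - N%:Z))).
rewrite (big_cat_nat (n := N)) ?leq_addr //= addrC; congr (_ + _).
  rewrite -{2}[N]add0n big_addn addnK; apply: eq_bigr => k _.
  by rewrite PoszD addrK.
rewrite [RHS]big_nat_rev big_add1 /=; apply: eq_big_nat => k /andP[_ kN].
have -> : (0 + N - k.+1)%N%:Z - N%:Z = - k.+1%:Z by lia.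
by rewrite exprnN.
Qed.

Lemma laurent_sumSr c w m n :
  laurent_sum c w m n.+1 - laurent_sum c w m n = c n%:Z * w ^ n%:Z.
Proof.
rewrite /laurent_sum big_nat_recr //=.
by move: (bigop _ _ _) (bigop _ _ _) (c n * _) => A B C; ring.
Qed.

Lemma laurent_sumSl c w m n : (0 < m)%N ->
  laurent_sum c w m.+1 n - laurent_sum c w m n = c (- m%:Z) * w ^ (- m%:Z).
Proof.
move=> m0; rewrite /laurent_sum (big_nat_recr m) //= exprnN.
by move: (bigop _ _ _) (bigop _ _ _) (c (- _) * _) => A B C; ring.
Qed.

Lemma laurent_term_small S f x0 c x (e : RR) :
  laurent_expansion_on abs S f x0 c -> S x -> 0 < e ->
  exists N : nat, forall k : int, (N <= `|k|)%N -> abs (c k * (x - x0) ^ k) < e.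
Proof.
move=> hc Sx e0; have [N hN] := hc x Sx e e0; exists N.+1.
have h m n : (N <= m)%N -> (N <= n)%N -> abs (laurent_sum c (x - x0) m n - f x) < e.
  exact: hN.
have diff m n m' n' : (N <= m)%N -> (N <= n)%N -> (N <= m')%N -> (N <= n')%N ->
    abs (laurent_sum c (x - x0) m n - laurent_sum c (x - x0) m' n') < e.
  by move=> *; apply: (@abs_trans_lt (f x)); [|rewrite absC]; apply: h.
case=> k /= Nk; first by rewrite -(laurent_sumSr c _ N) diff //; lia.
by rewrite NegzE -(laurent_sumSl c _ N) // diff //; lia.
Qed.

(** Cauchy's estimate. The size of a term is constant on the circle, so a cutoff N found at one
    point serves at all of them. Removing the small tail leaves a truncation bounded by e on the
    circle, a polynomial up to a power of z, to which [coef_le_circle] applies. *)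
Lemma laurent_coef_le S f x0 c y (e : RR) : 0 < e ->
  laurent_expansion_on abs S f x0 c -> y != 0 ->
  (forall z, abs z = 1 -> S (x0 + y * z)) ->
  (forall z, abs z = 1 -> abs (f (x0 + y * z)) <= e) ->
  forall k, abs (c k * y ^ k) <= e.
Proof.
move=> e0 hc y0 Sy fy k; have := Sy 1 abs1; rewrite mulr1 => Sy1.
have [N hN] := laurent_term_small hc Sy1 e0.
rewrite addrAC subrr add0r in hN.
have absyz z j : abs z = 1 -> abs (c j * (y * z) ^ j) = abs (c j * y ^ j).
  move=> z1; rewrite !absM; congr (_ * _).
  by case: j => j; rewrite ?NegzE -?exprnN -?exprnP ?absV !absX absM z1 mulr1.
have [kN|Nk] := leqP N `|k|; first exact: ltW (hN k kN).
have tail z m n : abs z = 1 -> abs (laurent_sum c (y * z) (N.+1 + m) (N + n)) <= e ->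
    abs (laurent_sum c (y * z) N.+1 N) <= e.
  move=> z1; elim: m => [|m IHm].
    rewrite addn0; elim: n => [|n IHn]; first by rewrite addn0.
    rewrite addnS => h; apply: IHn.
    rewrite -[laurent_sum _ _ _ _](subKr (laurent_sum c (y * z) N.+1 (N + n).+1)).
    by rewrite laurent_sumSr absB_le // absyz // ltW // hN // leq_addr.
  rewrite addnS => h; apply: IHm.
  rewrite -[laurent_sum _ _ _ _](subKr (laurent_sum c (y * z) (N.+1 + m).+1 (N + n))).
  rewrite laurent_sumSl ?addSn // absB_le // absyz // ltW // hN //.
  by rewrite abszN /= -addSn (leq_trans (leqnSn N)) ?leq_addr.
have circle z : abs z = 1 -> abs (laurent_sum c (y * z) N.+1 N) <= e.
  move=> z1; have [N' hN'] := hc _ (Sy z z1) e e0.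
  apply: (tail z N' N') => //.
  rewrite -[laurent_sum _ _ _ _](subrK (f (x0 + y * z))) absD_le ?fy //.
  have := hN' (N.+1 + N')%N (N + N')%N (leq_addl _ _) (leq_addl _ _).
  by rewrite [x0 + y * z - x0]addrAC subrr add0r => /ltW.
pose T := \poly_(j < N + N) (c (j%:Z - N%:Z) * y ^ (j%:Z - N%:Z)).
have Tz z : abs z = 1 -> abs T.[z] <= e.
  move=> z1; have z0 : z != 0 by rewrite -abs_gt0 z1 ltr01.
  have -> : T.[z] = z ^+ N * laurent_sum c (y * z) N.+1 N.
    rewrite laurent_sum_symm horner_poly mulr_sumr; apply: eq_bigr => j _.
    rewrite [RHS]mulrCA expfzMl -mulrA; congr (_ * _); rewrite [RHS]mulrCA; congr (_ * _).
    by rewrite !exprnP -expfzDr // addrCA subrr addr0.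
  by rewrite absM absX z1 expr1n mul1r circle.
pose j := absz (k + N%:Z); have jE : j%:Z = k + N%:Z by rewrite /j; lia.
have jN : (j < N + N)%N by lia.
by have := coef_le_circle Tz j; rewrite coef_poly jN jE addrK.
Qed.

Lemma laurent_expansion_add S f g x0 c d :
  laurent_expansion_on abs S f x0 c -> laurent_expansion_on abs S g x0 d ->
  laurent_expansion_on abs S (fun x => f x + g x) x0 (fun k => c k + d k).
Proof.
move=> hc hd x Sx e e0; have [N1 h1] := hc x Sx e e0; have [N2 h2] := hd x Sx e e0.
exists (N1 + N2)%N => m n Nm Nn.
have := absD_lt (h1 m n _ _) (h2 m n _ _).
rewrite !(leq_trans (leq_addr _ _) Nm, leq_trans (leq_addl _ _) Nm,
  leq_trans (leq_addr _ _) Nn, leq_trans (leq_addl _ _) Nn) => /(_ isT isT isT isT).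
congr (abs _ < _); under [X in _ = X + _ - _]eq_bigr do rewrite mulrDl.
under [X in _ = _ + X - _]eq_bigr do rewrite mulrDl.
by rewrite !big_split /=; move: (bigop _ _ _) (bigop _ _ _) (bigop _ _ _) (bigop _ _ _) => *; ring.
Qed.

Lemma laurent_expansion_scale S f x0 a c :
  laurent_expansion_on abs S f x0 c ->
  laurent_expansion_on abs S (fun x => a * f x) x0 (fun k => a * c k).
Proof.
move=> hc x Sx e e0; have a1 : 0 < abs a + 1 by rewrite ltr_wpDl ?abs_ge0.
have [N h] := hc x Sx _ (divr_gt0 e0 a1); exists N => m n Nm Nn.
have := h m n Nm Nn; rewrite ltr_pdivlMr // mulrC => hmn.
have {hmn} : abs (a * (\sum_(0 <= k < n) c k%:Z * (x - x0) ^+ k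
     + \sum_(1 <= k < m) c (- k%:Z) * (x - x0) ^- k - f x)) < e.
  rewrite absM; apply: le_lt_trans hmn; rewrite ler_wpM2r ?abs_ge0 //.
  by rewrite lerDl ler01.
congr (abs _ < _); rewrite !mulrDr mulrN !mulr_sumr.
by congr (_ + _ - _); apply: eq_bigr => k _; rewrite mulrA.
Qed.

(** Cauchy's estimate for the difference of two approximants makes each coefficient a Cauchy
    sequence. The estimate is uniform in the exponent at each point of S, so the partial sums
    converge along with the coefficients. Invariance of S under rotation supplies the circles. *)
Lemma laurent_expansion_lim S x0 f :
  ~ S x0 -> (forall x z, S x -> abs z = 1 -> S (x0 + (x - x0) * z)) ->
  (forall e : RR, 0 < e -> exists g c, laurent_expansion_on abs S g x0 c /\
     forall x, S x -> abs (f x - g x) < e) ->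
  exists c, laurent_expansion_on abs S f x0 c.
Proof.
move=> nSx0 circ lim; have [[y Sy]|S0] := pselect (S !=set0); last first.
  by exists (fun=> 0) => x Sx; case: S0; exists x.
pose e n := abs p%:R ^+ n.
have e0 n : 0 < e n by rewrite exprn_gt0 ?absp_gt0.
have e_small t : 0 < t -> exists N, forall n, (N <= n)%N -> e n < t.
  by apply: expr_lt_eps; rewrite abs_ge0 absp_lt1.
have e_decr m n : (m <= n)%N -> e n <= e m.
  by move=> mn; rewrite /e ler_wiXn2l ?abs_ge0 ?(ltW absp_lt1).
have /choice [g /choice [c hgc]] n := lim (e n) (e0 n).
have hc n := proj1 (hgc n); have fg n := proj2 (hgc n).
have cauchy m n k x : (m <= n)%N -> S x -> abs ((c m k - c n k) * (x - x0) ^ k) <= e m.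
  move=> mn Sx; have w0 : x - x0 != 0.
    by rewrite subr_eq0; apply: contra_not_neq nSx0 => <-.
  have hd := laurent_expansion_add (hc m) (laurent_expansion_scale (-1) (hc n)).
  rewrite -[- c n k]mulN1r.
  apply: (laurent_coef_le (e0 m) hd w0 _ _ k) => z z1; first exact: circ.
  have Sz := circ x z Sx z1; rewrite mulN1r ltW //.
  apply: (@abs_trans_lt (f (x0 + (x - x0) * z))); first by rewrite absC fg.
  by apply: lt_le_trans (fg n _ Sz) (e_decr _ _ mn).
have w0 : y - x0 != 0 by rewrite subr_eq0; apply: contra_not_neq nSx0 => <-.
have /choice [l hl] k : exists l, seq_lim abs (c^~ k) l.
  apply: (Cp_complete K_Cp) => t t0.
  have yk : 0 < abs ((y - x0) ^ k) by rewrite abs_gt0 expfz_neq0.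
  have [N hN] := e_small _ (mulr_gt0 t0 yk); exists N => m n Nm Nn.
  have close j : (N <= j)%N -> abs (c N k - c j k) < t.
    move=> Nj; rewrite -(ltr_pM2r yk) -absM.
    exact: le_lt_trans (cauchy _ _ k y Nj Sy) (hN N (leqnn N)).
  by apply: (@abs_trans_lt (c N k)); [rewrite absC|]; apply: close.
have l_near n k x : S x -> abs ((l k - c n k) * (x - x0) ^ k) <= e n.
  move=> Sx; have xk : 0 < abs ((x - x0) ^ k).
    rewrite abs_gt0 expfz_neq0 // subr_eq0.
    by apply: contra_not_neq nSx0 => <-.
  have [N hN] := hl k _ (divr_gt0 (e0 n) xk).
  rewrite -(subrKA (c (N + n)%N k)) mulrDl absD_le //.
    by rewrite absM -ler_pdivlMr // absC ltW // hN // leq_addr.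
  by rewrite -opprB mulNr absN cauchy // leq_addl.
exists l => x Sx t t0; have [n0 hn] := e_small t t0; have {hn} et := hn n0 (leqnn n0).
have [N hN] := hc n0 x Sx t t0; exists N => m n Nm Nn; rewrite -/(laurent_sum _ _ _ _).
apply: (@abs_trans_lt (laurent_sum (c n0) (x - x0) m n)).
  apply: le_lt_trans et; rewrite laurent_sumB.
  by apply: laurent_sum_le => [|k]; [exact: ltW | exact: l_near].
apply: (@abs_trans_lt (g n0 x)); first exact: hN.
by rewrite absC; apply: lt_trans (fg n0 x Sx) et.
Qed.

Lemma laurent_expansion_poly S x0 (P : {poly K}) :
  exists2 c, laurent_expansion_on abs S (horner P) x0 c & c (-1) = 0.
Proof.
pose Q := P \Po ('X + x0%:P).
exists (fun k => if k is Posz n then Q`_n else 0) => // x _ e e0.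
exists (size Q) => m n _ Qn; rewrite [X in _ + X - _]big1_seq ?addr0; last first.
  by move=> k /andP[_]; rewrite mem_index_iota; case: k => // k _; rewrite mul0r.
have -> : \sum_(0 <= k < n) Q`_k * (x - x0) ^+ k = Q.[x - x0].
  by rewrite (horner_coef_wide _ Qn) big_mkord.
by rewrite horner_comp !hornerE subrK subrr abs0.
Qed.

(** The geometric series 1 / (w - g) = sum of g^n w^(-n-1), with g = b - x0 and w = x - x0; [Negz n]
    is the exponent -n-1. *)
Lemma laurent_expansion_inner_pole S x0 b :
  (forall x, S x -> abs (b - x0) < abs (x - x0)) ->
  exists2 c, laurent_expansion_on abs S (fun x => (x - b)^-1) x0 c & c (-1) = 1.
Proof.
move=> hS; pose g := b - x0.
exists (fun k => if k is Negz n then g ^+ n else 0) => // x Sx e e0.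
have gw := hS x Sx; set w := x - x0 in gw *; have w_gt0 := le_lt_trans (abs_ge0 _) gw.
have w0 : w != 0 by rewrite -abs_gt0.
have gwE : x - b = w - g by rewrite /w /g; ring.
have wg0 : w - g != 0.
  by rewrite subr_eq0; apply: contraTneq gw => ->; rewrite ltxx.
have [||N hN] := @expr_lt_eps (abs (g / w)) (e * abs (w - g)).
- by rewrite abs_ge0 abs_div ltr_pdivrMr // mul1r.
- by rewrite mulr_gt0 ?abs_gt0.
exists N.+1 => -[//|m] n Nm _; rewrite [X in X + _ - _]big1_seq ?add0r; last first.
  by move=> k _; rewrite mul0r.
rewrite big_add1 /= gwE.
have -> : \sum_(0 <= i < m) g ^+ i * w ^- i.+1 = (1 - (g / w) ^+ m) / (w - g).
  have := subrX1 (g / w) m; rewrite big_mkord => /eqP.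
  rewrite -opprB eqr_oppLR => /eqP ->; rewrite -mulNr opprB mulrAC.
  have -> : (1 - g / w) / (w - g) = w^-1 by field; rewrite w0 wg0.
  rewrite mulr_sumr; apply: eq_bigr => i _.
  by rewrite exprMn exprVn exprSr invfM [RHS]mulrC mulrA.
rewrite mulrBl mul1r addrAC subrr add0r absN abs_div ltr_pdivrMr ?abs_gt0 //.
by rewrite absX hN.
Qed.

(** The other geometric series, 1 / (w - g) = - sum of w^n / g^(n+1), has no negative exponents. *)
Lemma laurent_expansion_outer_pole S x0 b :
  (forall x, S x -> abs (x - x0) < abs (b - x0)) ->
  exists2 c, laurent_expansion_on abs S (fun x => (x - b)^-1) x0 c & c (-1) = 0.
Proof.
move=> hS; pose g := b - x0.
exists (fun k => if k is Posz n then - g ^- n.+1 else 0) => // x Sx e e0.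
have wg := hS x Sx; set w := x - x0 in wg *; have g_gt0 := le_lt_trans (abs_ge0 _) wg.
have g0 : g != 0 by rewrite -abs_gt0.
have gwE : x - b = w - g by rewrite /w /g; ring.
have wg0 : w - g != 0.
  by rewrite subr_eq0; apply: contraTneq wg => ->; rewrite ltxx.
have [||N hN] := @expr_lt_eps (abs (w / g)) (e * abs (w - g)).
- by rewrite abs_ge0 abs_div ltr_pdivrMr // mul1r.
- by rewrite mulr_gt0 ?abs_gt0.
exists N => m n _ Nn; rewrite [X in _ + X - _]big1_seq ?addr0; last first.
  by move=> k /andP[_]; rewrite mem_index_iota; case: k => // k _; rewrite mul0r.
rewrite gwE.
have -> : \sum_(0 <= i < n) - g ^- i.+1 * w ^+ i = (1 - (w / g) ^+ n) / (w - g).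
  have := subrX1 (w / g) n; rewrite big_mkord => /eqP.
  rewrite -opprB eqr_oppLR => /eqP ->; rewrite -mulNr opprB mulrAC.
  have -> : (1 - w / g) / (w - g) = - g^-1 by field; rewrite g0 wg0.
  rewrite mulr_sumr; apply: eq_bigr => i _.
  by rewrite exprMn exprVn exprS invfM !mulNr -!mulrA [w ^+ i * _]mulrC.
rewrite mulrBl mul1r addrAC subrr add0r absN abs_div ltr_pdivrMr ?abs_gt0 //.
by rewrite absX hN.
Qed.

(* Powers of an [m]-th root of [p], for [m] large: the value group is dense. *)
Lemma ex_abs_between (r s : RR) : 0 < r -> r < s -> exists y, r <= abs y < s.
Proof.
move=> r0 rs; have s0 := lt_trans r0 rs.
have [|m hm] := @expr_lt_eps (r / s) (abs p%:R) _ absp_gt0.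
  by rewrite divr_ge0 ?ltW //= ltr_pdivrMr // mul1r.
have [//|t tm] := @ex_nth_root m.+1 p%:R.
have rst : r / s < abs t.
  rewrite ltNge; apply/negP => h; have := hm m.+1 (leqnSn m).
  by rewrite -tm absX ltNge lerXn2r ?nnegrE ?abs_ge0 // (le_trans (abs_ge0 t)).
have t1 : abs t < 1.
  rewrite ltNge; apply/negP => /(exprn_ege1 m.+1).
  by rewrite -absX tm leNgt absp_lt1.
have t0 : 0 < abs t by apply: le_lt_trans rst; rewrite divr_ge0 ?ltW.
have [||k0 hk0] := @expr_lt_eps (abs t) s^-1; first by rewrite abs_ge0.
  by rewrite invr_gt0.
(* The absolute values start above s and decrease by the factor |t| > r / s, so the first one below
   s cannot jump below r. *)
pose z j := t ^- k0 * t ^+ j.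
have z0 : s < abs (z 0%N).
  rewrite /z mulr1 absV absX -[s]invrK ltf_pV2 ?posrE ?invr_gt0 ?exprn_gt0 //.
  exact: hk0.
have ex : exists j, abs (z j) < s.
  have zp : 0 < abs (t ^- k0) by rewrite absV absX invr_gt0 exprn_gt0.
  have [|j hj] := @expr_lt_eps (abs t) (s / abs (t ^- k0)) _ (divr_gt0 s0 zp).
    by rewrite abs_ge0.
  by exists j; rewrite /z absM absX mulrC -ltr_pdivlMr // hj.
have := ex_minnP ex; case=> -[|j] hj jmin; first by have := lt_trans z0 hj; rewrite ltxx.
exists (z j.+1); rewrite hj andbT.
have : s <= abs (z j) by rewrite leNgt; apply/negP => /jmin; rewrite ltnn.
move=> sz; rewrite /z exprSr mulrA -/(z j) absM.
move: rst; rewrite ltr_pdivrMr // => /ltW h; apply: le_trans h _.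
by rewrite mulrC ler_wpM2r ?abs_ge0.
Qed.

(** Cauchy's estimate at exponent -1 on a non-empty circle in the common part of both annuli. It
    holds for every expansion c of f, hence for the one that [residue] picks. *)
Lemma laurent_residue_le f g x0 (r s R e : RR) c d : 0 < r -> r < s -> s <= R -> 0 < e ->
  laurent_expansion abs f x0 r c ->
  laurent_expansion_on abs [set x | r <= abs (x - x0) < s] g x0 d ->
  (forall x, r <= abs (x - x0) < s -> abs (f x - g x) <= e) ->
  abs (c (-1) - d (-1)) <= R * e.
Proof.
move=> r0 rs sR e0 [s' rs' hc] hd fg.
have [|y /andP[ry]] := @ex_abs_between r (Num.min s s') r0; first by rewrite lt_min rs.
rewrite lt_min => /andP[ys ys']; have y0 : 0 < abs y := lt_le_trans r0 ry.
pose S : set K := [set x | abs (x - x0) = abs y].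
have Sc : laurent_expansion_on abs S f x0 c.
  by move=> x Sx; apply: hc; rewrite /= Sx ry.
have Sd : laurent_expansion_on abs S (fun x => (-1) * g x) x0 (fun k => (-1) * d k).
  by apply: laurent_expansion_scale => x Sx; apply: hd; rewrite /= Sx ry.
have yz z : abs z = 1 -> abs (x0 + y * z - x0) = abs y.
  by move=> z1; rewrite addrAC subrr add0r absM z1 mulr1.
have y_neq0 : y != 0 by rewrite -abs_gt0.
have h := laurent_coef_le e0 (laurent_expansion_add Sc Sd) y_neq0 yz.
have {h} : abs ((c (-1) + -1 * d (-1)) * y ^ (-1)) <= e.
  by apply: h => z z1; rewrite mulN1r fg // yz // ry.
rewrite mulN1r absM -[y ^ (-1)]/(y ^- 1) absV expr1 ler_pdivrMr // mulrC => h.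
by apply: le_trans h _; rewrite ler_wpM2r ?(ltW e0) // ltW // (lt_le_trans ys).
Qed.

(** * Discs with holes *)

Lemma krasner_add D f g : krasner_analytic abs D f -> krasner_analytic abs D g ->
  krasner_analytic abs D (fun x => f x + g x).
Proof.
move=> [P1 [Q1 [Q10 h1]]] [P2 [Q2 [Q20 h2]]].
exists (fun n => P1 n * Q2 n + P2 n * Q1 n), (fun n => Q1 n * Q2 n); split.
  by move=> n x Dx; rewrite hornerM mulf_neq0 ?Q10 ?Q20.
move=> e e0; have [N1 {}h1] := h1 e e0; have [N2 {}h2] := h2 e e0.
exists (N1 + N2)%N => n Nn x Dx.
have -> : (P1 n * Q2 n + P2 n * Q1 n).[x] / (Q1 n * Q2 n).[x] =
    (P1 n).[x] / (Q1 n).[x] + (P2 n).[x] / (Q2 n).[x].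
  by rewrite !hornerE; field; rewrite Q10 ?Q20.
rewrite opprD addrACA absD_lt ?h1 ?h2 //; first exact: leq_trans (leq_addr _ _) Nn.
exact: leq_trans (leq_addl _ _) Nn.
Qed.

Lemma krasner_scale D c f : krasner_analytic abs D f ->
  krasner_analytic abs D (fun x => c * f x).
Proof.
move=> [P [Q [Q0 h]]]; exists (fun n => c *: P n), Q; split=> // e e0.
have c1 : 0 < abs c + 1 by rewrite ltr_wpDl ?abs_ge0.
have [N hN] := h _ (divr_gt0 e0 c1); exists N => n Nn x Dx.
rewrite hornerZ -mulrA -mulrBr absM; have := hN n Nn x Dx.
rewrite ltr_pdivlMr // mulrC; apply: le_lt_trans.
by rewrite ler_wpM2r ?abs_ge0 // lerDl ler01.
Qed.

Lemma krasner_simple D f : simple_fraction D f -> krasner_analytic abs D f.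
Proof.
elim=> {f} [P|c nDc|f g _ hf _ hg|c f _ hf].
- exists (fun=> P), (fun=> 1); split; first by move=> _ x _; rewrite hornerC oner_neq0.
  by move=> e e0; exists 0%N => n _ x _; rewrite hornerC divr1 subrr abs0.
- exists (fun=> 1), (fun=> 'X - c%:P); split.
    move=> _ x Dx; rewrite hornerXsubC subr_eq0.
    by apply: contra_not_neq nDc => <-.
  by move=> e e0; exists 0%N => n _ x _; rewrite hornerXsubC hornerC mul1r subrr abs0.
- exact: krasner_add.
- exact: krasner_scale.
Qed.

Lemma seq_lim_add (u v : nat -> K) l m : seq_lim abs u l -> seq_lim abs v m ->
  seq_lim abs (fun k => u k + v k) (l + m).
Proof.
move=> hu hv e e0; have [N1 h1] := hu e e0; have [N2 h2] := hv e e0.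
exists (N1 + N2)%N => n Nn; rewrite opprD addrACA absD_lt ?h1 ?h2 //.
  exact: leq_trans (leq_addr _ _) Nn.
exact: leq_trans (leq_addl _ _) Nn.
Qed.

Lemma seq_lim_scale (u : nat -> K) c l : seq_lim abs u l ->
  seq_lim abs (fun k => c * u k) (c * l).
Proof.
move=> hu e e0; have c1 : 0 < abs c + 1 by rewrite ltr_wpDl ?abs_ge0.
have [N hN] := hu _ (divr_gt0 e0 c1); exists N => n /hN.
rewrite -mulrBr absM ltr_pdivlMr // mulrC; apply: le_lt_trans.
by rewrite ler_wpM2r ?abs_ge0 // lerDl ler01.
Qed.

(** By injectivity of Frobenius, u^(p^m) congruent to 1 would force u congruent to 1. *)
Lemma abs_1_sub_Xpn u m : abs u <= 1 -> abs (1 - u) = 1 -> abs (1 - u ^+ (p ^ m)) = 1.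
Proof.
move=> u1 h; apply/eqP; rewrite eq_le absB_le ?abs1 ?absX ?exprn_ile1 ?abs_ge0 //=.
rewrite leNgt; apply/negP; rewrite -[X in X - _](expr1n _ (p ^ m)).
by move=> /abs_subXpn_lt1; rewrite h ltxx abs1 => /(_ (lexx _) u1).
Qed.

Lemma abs_sub_center y z c : abs (y - z) < abs (c - z) -> abs (c - y) = abs (c - z).
Proof.
move=> h; apply: abs_isosceles; rewrite (_ : c - y - (c - z) = - (y - z)); last by ring.
by rewrite absN.
Qed.

Section HoledDisc.

Variables (a b : K) (R : RR) (M : nat) (x : 'I_M -> K) (r : 'I_M -> RR).
Hypotheses (R_gt0 : 0 < R) (r_lt : forall i, 0 < r i < R).
Hypothesis discs_disjoint : trivIset setT (fun i => cdisc abs (x i) (r i)).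
Hypotheses (b_a : abs (b - a) = R) (b_x : forall i, abs (b - x i) = R).

Let D := cdisc abs a R `\` \bigcup_(i in [set: 'I_M]) odisc abs (x i) (r i).

Lemma abs_a_sub_center i : abs (x i - a) <= R.
Proof. by apply: (@abs_trans_le b); rewrite ?b_a // absC b_x. Qed.

Lemma holed_discP y : D y <-> abs (y - a) <= R /\ forall i, r i <= abs (y - x i).
Proof.
split=> [[ya ny]|[ya yx]]; split=> //.
  by move=> i; rewrite leNgt; apply/negP => yi; apply: ny; exists i.
by move=> [i _]; rewrite /odisc /= ltNge yx.
Qed.

Lemma notin_holed_disc c : ~ D c -> R < abs (c - a) \/ exists i, abs (c - x i) < r i.
Proof.
move=> nDc; have [ca|] := leP (abs (c - a)) R; last by left.
right; apply: contrapT => h; apply: nDc; apply/holed_discP; split=> // i.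
by rewrite leNgt; apply/negP => ci; apply: h; exists i.
Qed.

Lemma far_center c i : R < abs (c - a) -> abs (c - x i) = abs (c - a).
Proof.
move=> ca; apply: abs_sub_center.
exact: le_lt_trans (abs_a_sub_center i) ca.
Qed.

Lemma holed_disc_closed : abs_closed D.
Proof.
move=> c /notin_holed_disc[ca|[i ci]].
  exists R => // y /holed_discP[ya _]; rewrite absC.
  suff -> : abs (c - y) = abs (c - a) by apply: ltW.
  apply: abs_sub_center; exact: le_lt_trans ya ca.
exists (r i); first by case/andP: (r_lt i).
move=> y /holed_discP[_ /(_ i) yi].
suff -> : abs (y - c) = abs (y - x i) by [].
by apply: abs_sub_center; apply: lt_le_trans yi.
Qed.

Lemma centers_far i j : i != j -> r i < abs (x i - x j) /\ r j < abs (x i - x j).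
Proof.
move=> ij; have ri k : 0 <= r k by case/andP: (r_lt k) => /ltW.
split; rewrite ltNge; apply: contraNN ij => h; apply/eqP; apply: discs_disjoint => //.
  by exists (x j); split; rewrite /cdisc /= ?subrr ?abs0 // absC.
by exists (x i); split; rewrite /cdisc /= ?subrr ?abs0.
Qed.

(** The annulus from r_i up to this radius avoids all the holes and stays in D. Disjointness of the
    closed discs makes the radius exceed r_i. *)
Definition annulus_radius i : RR := \big[Num.min/R]_(j | j != i) abs (x i - x j).

Definition annulus i : set K := [set y | r i <= abs (y - x i) < annulus_radius i].

Lemma annulus_radius_gt i : r i < annulus_radius i.
Proof.
rewrite /annulus_radius; elim/big_ind: _ => [|s t rs rt|j ji].
- by case/andP: (r_lt i).
- by rewrite lt_min rs.
- by case: (centers_far (i := i) (j := j)); rewrite // eq_sym.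
Qed.

Lemma annulus_radius_le i : annulus_radius i <= R.
Proof. exact: bigmin_le_id. Qed.

Lemma annulus_radius_le_dist i j : j != i -> annulus_radius i <= abs (x i - x j).
Proof. by move=> ji; apply: bigmin_le_cond. Qed.

Lemma annulus_sub i : annulus i `<=` D.
Proof.
move=> y /andP[ry ys]; apply/holed_discP; split.
  apply: abs_trans_le (abs_a_sub_center i).
  exact: le_trans (ltW ys) (annulus_radius_le i).
move=> j; have [->//|ji] := eqVneq j i.
have xij := annulus_radius_le_dist ji.
have -> : abs (y - x j) = abs (x i - x j).
  rewrite absC [RHS]absC; apply: abs_sub_center; apply: lt_le_trans ys _.
  by rewrite [leRHS]absC.
by rewrite ltW //; have [] := centers_far (i := i) (j := j); rewrite // eq_sym.
Qed.

Lemma arc_sub : odisc abs b (abs (b - a)) `<=` D.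
Proof.
move=> y; rewrite /odisc /= b_a => yb; apply/holed_discP; split.
  by apply: abs_trans_le (ltW yb) _; rewrite b_a.
move=> i; suff -> : abs (y - x i) = R by case/andP: (r_lt i) => _ /ltW.
by rewrite -(b_x i) absC [RHS]absC; apply: abs_sub_center; rewrite [ltRHS]absC b_x.
Qed.

(** If c is not in hole i, it lies beyond the large disc or in another hole j, where |c - x_i| =
    |x_j - x_i|; either way it is no closer to x_i than the outer radius of the annulus. *)
Lemma pole_laurent c i : ~ D c -> exists2 d,
  laurent_expansion_on abs (annulus i) (fun y => (y - c)^-1) (x i) d &
  d (-1) = (if abs (c - x i) < r i then 1 else 0).
Proof.
move=> nDc; have [ci|ci] := ltP (abs (c - x i)) (r i).
  by apply: laurent_expansion_inner_pole => y /andP[ry _]; apply: lt_le_trans ry.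
apply: laurent_expansion_outer_pole => y /andP[_ ys]; apply: lt_le_trans ys _.
have [ca|[j cj]] := notin_holed_disc nDc.
  by rewrite (far_center i ca) (le_trans (annulus_radius_le i)) ?ltW.
have [ji|ij] := eqVneq j i; first by move: cj; rewrite ji ltNge ci.
rewrite [leRHS]absC (@abs_sub_center c (x j)); first exact: annulus_radius_le_dist.
have [_ h] : r i < abs (x i - x j) /\ r j < abs (x i - x j).
  by apply: centers_far; rewrite eq_sym.
exact: lt_trans h.
Qed.

Let u i := (a - x i) / (a - b).
Let w i := teichmuller p abs (u i).

Lemma ab_neq0 : a - b != 0.
Proof. by rewrite -abs_gt0 absC b_a. Qed.

Lemma abs_u_le1 i : abs (u i) <= 1.
Proof.
rewrite abs_div [abs (a - b)]absC b_a ler_pdivrMr // mul1r absC.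
exact: abs_a_sub_center.
Qed.

(** The hypothesis |b - x_i| = |b - a| in its working form: the residue class of u_i is not 1. *)
Lemma abs_1_sub_u i : abs (1 - u i) = 1.
Proof.
have -> : 1 - u i = (x i - b) / (a - b) by rewrite /u; field; exact: ab_neq0.
by rewrite abs_div ![abs (_ - b)]absC b_a b_x divff ?gt_eqF.
Qed.

Lemma abs_1_sub_near i v m : abs (u i - v) < 1 -> abs v <= 1 ->
  abs (1 - v ^+ (p ^ m)) = 1.
Proof.
move=> uv v1; apply: abs_1_sub_Xpn => //; rewrite -(abs_1_sub_u i).
apply: abs_isosceles; rewrite (_ : _ - _ = u i - v); last by ring.
by rewrite abs_1_sub_u.
Qed.

Lemma near_center c i : abs (c - x i) < r i ->
  abs (u i - (c - a) / (b - a)) < 1 /\ abs ((c - a) / (b - a)) <= 1.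
Proof.
move=> ci; have uc : abs (u i - (c - a) / (b - a)) < 1.
  have -> : u i - (c - a) / (b - a) = (c - x i) / (a - b).
    have ba0 : b - a != 0 by rewrite -opprB oppr_eq0 ab_neq0.
    by rewrite /u; field; rewrite ba0 ab_neq0.
  rewrite abs_div [abs (a - b)]absC b_a ltr_pdivrMr // mul1r.
  by apply: lt_trans ci _; case/andP: (r_lt i).
by split=> //; rewrite -[_ / _](subKr (u i)) absB_le ?abs_u_le1 // ltW.
Qed.

(** * Limits of the means of order p^(alpha + lam k) *)

Variables (alpha lam : nat).
Hypothesis lam_gt0 : (0 < lam)%N.
Hypothesis w_period : forall i k, w i ^+ (p ^ (lam * k)) = w i.

Let q k := (p ^ (alpha + lam * k))%N.

Lemma w_expr_q i k : w i ^+ q k = w i ^+ (p ^ alpha).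
Proof. by rewrite /q expnD mulnC exprM w_period. Qed.

Lemma ltn_q k : (k < q k)%N.
Proof.
apply: leq_ltn_trans (ltn_expl _ (prime_gt1 p_prime)).
by rewrite (leq_trans _ (leq_addl _ _)) // leq_pmull.
Qed.

Lemma q_gt0 k : (0 < q k)%N.
Proof. exact: leq_ltn_trans (ltn_q k). Qed.

Let C i := 1 / (1 - w i ^+ (p ^ alpha)).

Lemma abs_C i : abs (C i) = 1.
Proof.
have [uw w1 _] := teichmullerP (abs_u_le1 i).
by rewrite abs_div abs1 (@abs_1_sub_near i) // divr1.
Qed.

Lemma arc_mean_inner_pole c i : abs (c - x i) < r i ->
  seq_lim abs (fun k => arc_mean a b (fun y => (y - c)^-1) (q k)) (C i).
Proof.
move=> ci e e0; have [uv v1] := near_center ci; set v := (c - a) / (b - a) in uv v1 *.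
have [uw w1 _] := teichmullerP (abs_u_le1 i); rewrite -/(w i) in uw w1.
have vw : abs (v - w i) < 1 by apply: abs_trans_lt uw; rewrite absC.
(* The contraction ratio of p-th powers on the pair v, w_i. Both denominators have absolute value 1,
   so the error is |v^q - w_i^q|, at most a power of t. *)
pose t := Num.max (abs (v - w i)) (abs p%:R).
have t1 : t < 1 by rewrite gt_max vw absp_lt1.
have [|N hN] := @expr_lt_eps t e _ e0; first by rewrite le_max abs_ge0.
exists N => k Nk; have v0 : abs (1 - v ^+ q k) = 1 by apply: abs_1_sub_near uv v1.
have w0 : abs (1 - w i ^+ q k) = 1 by apply: abs_1_sub_near uw w1.
have nz y : abs y = 1 -> y != 0 by rewrite -abs_gt0 => ->; apply: ltr01.
rewrite arc_mean_pole ?q_gt0 //; last 2 first.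
- by rewrite -subr_eq0 ab_neq0.
- by have := nz _ v0; rewrite subr_eq0 eq_sym.
rewrite /C -(w_expr_q i k) -/v.
have -> : (1 - v ^+ q k)^-1 - 1 / (1 - w i ^+ q k) =
    (v ^+ q k - w i ^+ q k) / ((1 - v ^+ q k) * (1 - w i ^+ q k)).
  by field; rewrite !nz.
rewrite abs_div absM v0 w0 mulr1 divr1.
apply: le_lt_trans (_ : t ^+ (alpha + lam * k).+1 < _).
  by apply: abs_subXpn_le; rewrite ?le_max ?lexx ?orbT // ltW.
apply: hN; apply: leq_trans Nk _; rewrite ltnW // ltnS.
by rewrite (leq_trans _ (leq_addl _ _)) // leq_pmull.
Qed.

Lemma arc_mean_outer_pole c : R < abs (c - a) ->
  seq_lim abs (fun k => arc_mean a b (fun y => (y - c)^-1) (q k)) 0.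
Proof.
move=> ca e e0; pose v := (c - a) / (b - a).
have v1 : 1 < abs v by rewrite abs_div b_a ltr_pdivlMr // mul1r.
have v0 : 0 < abs v := lt_trans ltr01 v1.
have [|N hN] := @expr_lt_eps (abs v)^-1 e _ e0.
  by rewrite invr_ge0 abs_ge0 invf_lt1.
exists N => k Nk; have vq : 1 < abs (v ^+ q k).
  by rewrite absX exprn_egt1 // -lt0n q_gt0.
have vE : abs (1 - v ^+ q k) = abs (v ^+ q k).
  by rewrite absC; apply: abs_isosceles; rewrite addrAC subrr add0r absN abs1.
rewrite arc_mean_pole ?q_gt0 //; last 2 first.
- by rewrite -subr_eq0 ab_neq0.
- by rewrite -/v; apply: contraTneq vq => ->; rewrite abs1 ltxx.
rewrite -/v subr0 absV vE absX -exprVn hN // ltnW //.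
exact: leq_ltn_trans (ltn_q k).
Qed.

(** Residues and limit go through one induction with common numbers t_i. These are coefficients of
    some expansion instead of values of [residue], whose choice operator hides additivity. *)
Lemma simple_fraction_limits g : simple_fraction D g -> exists t : 'I_M -> K,
  (forall i, exists2 d, laurent_expansion_on abs (annulus i) g (x i) d & d (-1) = t i) /\
  seq_lim abs (fun k => arc_mean a b g (q k)) (\sum_i C i * t i).
Proof.
elim=> {g} [P|c nDc|f g _ [t [ht lf]] _ [t' [ht' lg]]|c f _ [t [ht lf]]].
- exists (fun=> 0); split=> [i|e e0]; first exact: laurent_expansion_poly.
  exists (size P) => k Pk; rewrite big1 ?subr0 => [|i _]; last by rewrite mulr0.
  by rewrite arc_mean_poly ?abs0 // (leq_ltn_trans Pk) ?ltn_q.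
- exists (fun i => (if abs (c - x i) < r i then 1 else 0)); split=> [i|].
    exact: pole_laurent.
  have [ca|[i ci]] := notin_holed_disc nDc.
    rewrite big1 => [|i _]; first exact: arc_mean_outer_pole.
    rewrite (far_center i ca) ltNge (_ : r i <= _) ?mulr0 //.
    by case/andP: (r_lt i) => _ /ltW h; apply: le_trans h (ltW ca).
  rewrite (bigD1 i) //= ci mulr1 big1 ?addr0; first exact: arc_mean_inner_pole.
  move=> j ji; case: ltP => cj; last by rewrite mulr0.
  have [h1 h2] := centers_far ji.
  have : abs (x j - x i) < abs (x j - x i).
    by apply: (@abs_trans_lt c); [rewrite absC; apply: lt_trans h1 | apply: lt_trans h2].
  by rewrite ltxx.
- exists (fun i => t i + t' i); split=> [i|].
    have [d hd dt] := ht i; have [d' hd' dt'] := ht' i.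
    by eexists; [apply: laurent_expansion_add hd hd' | rewrite /= dt dt'].
  under eq_bigr do rewrite mulrDr; rewrite big_split.
  have := seq_lim_add lf lg; congr seq_lim; apply/funext => k.
  by rewrite arc_mean_add ?q_gt0.
- exists (fun i => c * t i); split=> [i|].
    have [d hd dt] := ht i.
    by eexists; [apply: laurent_expansion_scale hd | rewrite /= dt].
  under eq_bigr do rewrite mulrCA; rewrite -mulr_sumr.
  have := seq_lim_scale c lf; congr seq_lim; apply/funext => k.
  by rewrite arc_mean_scale ?q_gt0.
Qed.

(** This excludes the default value 0 of [residue]: the expansions of approximating simple fractions
    converge on the annulus around hole i. *)
Lemma krasner_residueP f i : krasner_analytic abs D f ->
  exists2 c, laurent_expansion abs f (x i) (r i) c &
             residue abs f (x i) (r i) = c (-1).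
Proof.
move=> fK; have ri : 0 < r i by case/andP: (r_lt i).
suff [c hc] : exists c, laurent_expansion_on abs (annulus i) f (x i) c.
  apply: (@xgetPex _ 0 [set t | exists2 c : int -> K,
    laurent_expansion abs f (x i) (r i) c & t = c (-1)]).
  by exists (c (-1)), c => //; exists (annulus_radius i) => //; apply: annulus_radius_gt.
apply: laurent_expansion_lim.
- by rewrite /annulus /= subrr abs0 leNgt ri.
- by move=> y z hy z1; rewrite /annulus /= addrAC subrr add0r absM z1 mulr1.
move=> e e0; have [g sg fg] := krasner_simple_approx holed_disc_closed fK e0.
have [t [ht _]] := simple_fraction_limits sg; have [d hd _] := ht i.
by exists g, d; split=> // y /annulus_sub Dy; apply: fg.
Qed.

Lemma krasner_arc_mean_lim f : krasner_analytic abs D f ->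
  seq_lim abs (fun k => arc_mean a b f (q k))
    (\sum_i C i * residue abs f (x i) (r i)).
Proof.
(* Means and residues both magnify the error of approximation by at most R; the half turns the
   resulting weak inequalities into strict ones. *)
move=> fK e e0; have d0 : 0 < e / 2 / R by rewrite !divr_gt0.
have Rd : R * (e / 2 / R) < e by rewrite mulrC divfK ?gt_eqF //; lra.
have [g sg fg] := krasner_simple_approx holed_disc_closed fK d0.
have [t [ht /(_ e e0)[N hN]]] := simple_fraction_limits sg; exists N => k /hN hk.
apply: (@abs_trans_lt (arc_mean a b g (q k))).
  apply: le_lt_trans Rd; rewrite -arc_mean_sub ?q_gt0 // -{1}b_a.
  apply: (arc_mean_le (D := D)) => //; first by rewrite -subr_eq0 ab_neq0.
  - exact: arc_sub.
  - have := krasner_add fK (krasner_scale (-1) (krasner_simple sg)).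
    by congr krasner_analytic; apply/funext => y; rewrite mulN1r.
  - by move=> y Dy; rewrite ltW ?fg.
apply: abs_trans_lt hk _; rewrite -sumrB; apply: le_lt_trans Rd.
apply: abs_sum_le => [|i _]; first by rewrite mulr_ge0 ?ltW.
rewrite -mulrBr absM abs_C mul1r absC.
have [c hc ->] := krasner_residueP i fK; have [d hd <-] := ht i.
apply: laurent_residue_le hc hd _ => //.
- by case/andP: (r_lt i).
- exact: annulus_radius_gt.
- exact: annulus_radius_le.
- by move=> y hy; apply/ltW/fg/(@annulus_sub i).
Qed.

End HoledDisc.

End Cp.

Theorem theorem6p2 (RR : realType) (p : nat) (p_prime : prime p)
  (p_odd : odd p) (K : fieldType) (abs : K -> RR) (K_Cp : is_Cp p abs)
  (a b : K) (R : RR) (R_gt0 : 0 < R)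
  (M : nat) (x : 'I_M -> K) (r : 'I_M -> RR)
  (r_lt : forall i, 0 < r i < R)
  (discs_disjoint : trivIset setT (fun i => cdisc abs (x i) (r i)))
  (b_a : abs (b - a) = R) (b_x : forall i, abs (b - x i) = R)
  (alpha : nat) (f : K -> K)
  (f_analytic : krasner_analytic abs
     (cdisc abs a R `\` \bigcup_(i in [set: 'I_M]) odisc abs (x i) (r i)) f) :
  arc_integral p abs a b (Phi alpha%:Z) f
    (\sum_(i < M)
       1 / (1 - teichmuller p abs ((a - x i) / (a - b)) ^+ (p ^ alpha))
       * residue abs f (x i) (r i)).
Proof.
have u1 i : abs ((a - x i) / (a - b)) <= 1 := abs_u_le1 p_prime K_Cp R_gt0 b_a b_x i.
have /choice [l hl] (i : 'I_M) : exists l, (0 < l)%N /\ forall k, (l %| k)%N ->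
    teichmuller p abs ((a - x i) / (a - b)) ^+ (p ^ k) =
    teichmuller p abs ((a - x i) / (a - b)).
  by have [_ _ [l l0 hl]] := teichmullerP p_prime p_odd K_Cp (u1 i); exists l.
pose lam := (\prod_i l i)%N.
have lam_gt0 : (0 < lam)%N by rewrite prodn_gt0 // => i; case: (hl i).
(* Starting at k = 1 keeps alpha + lam k positive even for alpha = 0. *)
have start_gt0 : (0 < 1)%N by [].
have phi_gt0 k : (1 <= k)%N -> (0 < alpha + lam * k)%N.
  by move=> k1; rewrite addn_gt0 muln_gt0 lam_gt0 k1 orbT.
have phi_incr k m : (1 <= k)%N -> (k < m)%N -> (alpha + lam * k < alpha + lam * m)%N.
  by move=> _ km; rewrite ltn_add2l ltn_pmul2l.
(* The same path sequence serves for every [e], since lam depends only on the periods of the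
   Teichmueller values. *)
move=> e e0; exists (PathSeq start_gt0 phi_gt0 phi_incr); first by exists lam.
have period i k : teichmuller p abs ((a - x i) / (a - b)) ^+ (p ^ (lam * k)) =
    teichmuller p abs ((a - x i) / (a - b)).
  by case: (hl i) => _; apply; rewrite dvdn_mulr // /lam (bigD1 i) //= dvdn_mulr.
have [N hN] := krasner_arc_mean_lim p_prime p_odd K_Cp R_gt0 r_lt discs_disjoint
  b_a b_x alpha lam_gt0 period f_analytic e0.
by exists N => k _ /ltnW /hN; rewrite path_averageE.
Qed.
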